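(* Let $p$ be a prime number, let $A$ be the ring of integers in the Hilbert class field of $\mathbb{Q}(e^{2\pi i/p})$, and let $P$ be a prime ideal of $A$ containing $p$. Set $(\mathcal{O}, (\pi)) = (A_P, PA_P)$. Let $G \subseteq GL_3(\mathcal{O})$ be a finite $p$-group, and let $G$ act linearly on $R = \mathcal{O}[X,Y,Z]$ (fixing $\mathcal{O}$). Assume that the natural map $G \to GL_3(\mathcal{O}/(\pi))$ is trivial. Then $R^G$ is Cohen-Macaulay.
   Context: $R=\mathcal{O}[X,Y,Z]$ is graded with $R_0=\mathcal{O}$ and the variables in degree $1$; $G$ acts by graded $\mathcal{O}$-algebra automorphisms, acting on $R_1 = \mathcal{O}X\oplus \mathcal{O}Y\oplus \mathcal{O}Z$ through the inclusion $G\subseteq GL_3(\mathcal{O})$. $R^G$ is the ring of invariants. $(\mathcal{O},(\pi))$ is a discrete valuation ring with uniformizer $\pi$. *)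

(* Defs.v *)
From HB Require Import structures.
From mathcomp Require Import all_boot all_order all_algebra all_fingroup.
From mathcomp Require Import all_solvable all_field all_character.
From mathcomp Require Import boolp mpoly.

Set Implicit Arguments.
Unset Strict Implicit.
Unset Printing Implicit Defensive.

Import GRing.Theory Num.Theory.
Local Open Scope ring_scope.
Local Open Scope quotient_scope.

Local Notation "x %:F" := (tofrac x).

(* A subring S of a field, as an integral domain in its own right: its units
   are the nonzero elements whose inverse in the field lies in S. *)
Section SubDomain.
Variables (F : fieldType) (S : subringClosed F).

Record sub_domain := SubDomain {
  sd_val : F;
  sd_valP : sd_val \in (S : {pred F}) }.

HB.instance Definition _ := [isSub for sd_val].
HB.instance Definition _ := [Choice of sub_domain by <:].
HB.instance Definition _ := [SubChoice_isSubComNzRing of sub_domain by <:].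

Definition sd_unit : {pred sub_domain} :=
  fun x => (sd_val x != 0) && ((sd_val x)^-1 \in (S : {pred F})).
Definition sd_inv (x : sub_domain) : sub_domain := insubd x (sd_val x)^-1.

Lemma sd_mulVr : {in sd_unit, left_inverse 1 sd_inv *%R}.
Proof.
move=> x /andP[x0 xV]; apply: val_inj; rewrite rmorphM rmorph1.
have iE : sd_val (sd_inv x) = (sd_val x)^-1 by rewrite [LHS]val_insubd xV.
by rewrite /= iE mulVf.
Qed.

Lemma sd_unitP (x y : sub_domain) : y * x = 1 -> sd_unit x.
Proof.
move=> /(congr1 val); rewrite rmorphM rmorph1 /= => yx1.
have x0 : sd_val x != 0.
  by apply: contra_eq_neq yx1 => ->; rewrite mulr0 eq_sym oner_neq0.
apply/andP; split=> //.
suff -> : (sd_val x)^-1 = sd_val y by exact: sd_valP.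
by apply: (mulIf x0); rewrite mulVf.
Qed.

Lemma sd_inv_out : {in [predC sd_unit], sd_inv =1 id}.
Proof.
move=> x; rewrite inE negb_and negbK => /orP[/eqP x0|xV]; apply: val_inj;
  rewrite [LHS]val_insubd; last by rewrite (negPf xV).
by rewrite x0 invr0; case: ifP.
Qed.

HB.instance Definition _ :=
  GRing.ComNzRing_hasMulInverse.Build sub_domain sd_mulVr sd_unitP sd_inv_out.

Lemma sd_idomain (x y : sub_domain) : x * y = 0 -> (x == 0) || (y == 0).
Proof.
move=> /(congr1 val); rewrite rmorphM rmorph0 => /eqP.
by rewrite mulf_eq0 -!val_eqE.
Qed.

HB.instance Definition _ :=
  GRing.ComUnitRing_isIntegral.Build sub_domain sd_idomain.

End SubDomain.

Section Integers.
Variable L : fieldType.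

Definition algebraic_integer : {pred L} :=
  fun x => `[< integralOver (intr : int -> L) x >].

Lemma algebraic_integer_closed : subring_closed algebraic_integer.
Proof.
split=> [|x y /asboolP hx /asboolP hy|x y /asboolP hx /asboolP hy];
  apply/asboolP.
- exact: integral1.
- exact: integral_sub.
- exact: integral_mul.
Qed.

HB.instance Definition _ :=
  GRing.isSubringClosed.Build L algebraic_integer algebraic_integer_closed.

Definition ring_of_integers := sub_domain algebraic_integer.
HB.instance Definition _ := GRing.IntegralDomain.on ring_of_integers.
HB.instance Definition _ := SubType.on ring_of_integers.

End Integers.
Arguments algebraic_integer L _ : clear implicits.

Section Localization.
Variables (A : idomainType) (P : prime_idealr A).

Definition localization_pred : {pred {fraction A}} :=
  fun x => `[< exists a s : A, s \notin P /\ x = a%:F / s%:F >].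

Lemma tofrac_notin (s : A) : s \notin P -> s%:F != 0.
Proof. by apply: contra; rewrite tofrac_eq0 => /eqP->; exact: rpred0. Qed.

Lemma notin_prime1 : 1 \notin P.
Proof. by rewrite idealr1. Qed.

Lemma notin_primeM (s t : A) : s \notin P -> t \notin P -> s * t \notin P.
Proof. by move=> hs ht; rewrite prime_idealrM negb_or hs. Qed.

Lemma localization_closed : subring_closed localization_pred.
Proof.
split=> [|x y /asboolP[a [s [hs ->]]] /asboolP[b [t [ht ->]]]
         |x y /asboolP[a [s [hs ->]]] /asboolP[b [t [ht ->]]]]; apply/asboolP.
- by exists 1, 1; split; rewrite ?notin_prime1 // tofrac1 divr1.
- exists (a * t - b * s), (s * t); split; first exact: notin_primeM.
  rewrite -mulNr addf_div ?tofrac_notin //.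
  by rewrite mulNr -!tofracM -tofracB.
- exists (a * b), (s * t); split; first exact: notin_primeM.
  by rewrite mulf_div -!tofracM.
Qed.

HB.instance Definition _ :=
  GRing.isSubringClosed.Build {fraction A} localization_pred
    localization_closed.

Definition localization := sub_domain localization_pred.
HB.instance Definition _ := GRing.IntegralDomain.on localization.
HB.instance Definition _ := SubType.on localization.

(* The ideal P A_P. *)
Definition localization_ideal : {pred localization} :=
  fun x => `[< exists a s : A, [/\ a \in P, s \notin P
                                 & val x = a%:F / s%:F] >].

Lemma localization_idealr : idealr_closed localization_ideal.
Proof.
split.
- by apply/asboolP; exists 0, 1; rewrite rpred0 notin_prime1 tofrac0 mul0r.
- apply/asboolPn => -[a [s [ha hs h1]]].
  have as_eq : a%:F = s%:F.
    by rewrite -[LHS](divfK (tofrac_notin hs)) -h1 rmorph1 mul1r.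
  by move/eqP: as_eq hs; rewrite tofrac_eq => /eqP <-; rewrite ha.
- move=> c u v /asboolP[a [s [ha hs hu]]] /asboolP[b [t [hb ht hv]]].
  have /asboolP[d [r [hr hc]]] := valP c.
  apply/asboolP; exists (d * a * t + b * (r * s)), (r * s * t).
  split; last 1 first.
  + rewrite rmorphD rmorphM /= -[sd_val u]/(val u) hu -[sd_val v]/(val v) hv.
    rewrite hc mulf_div -!tofracM.
    by rewrite addf_div ?tofrac_notin ?notin_primeM // -!tofracM -tofracD.
  + by rewrite rpredD ?prime_idealrM ?ha ?hb ?orbT.
  + by rewrite !notin_primeM.
Qed.

HB.instance Definition _ :=
  isIdealr.Build localization localization_ideal localization_idealr.

End Localization.
Arguments localization_ideal {A} P _.

Section InvariantRing.
Variables (O : idomainType) (n : nat).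

(* The substitution X_j |-> \sum_i M i j X_i: the action of M on the span of
   the variables, with M acting on column vectors. *)
Definition linear_subst (M : 'M[O]_n) (f : {mpoly O[n]}) : {mpoly O[n]} :=
  f \mPo [tuple \sum_(i < n) M i j *: 'X_i | j < n].

Variables (gT : finGroupType) (G : {group gT}) (rG : mx_representation O G n).

Definition invariant_poly : {pred {mpoly O[n]}} :=
  fun f => [forall g in G, linear_subst (rG g) f == f].

Lemma invariant_polyP f :
  reflect {in G, forall g, linear_subst (rG g) f = f} (f \in invariant_poly).
Proof. by apply: (iffP forall_inP) => h g /h /eqP. Qed.

Lemma invariant_poly_closed : divring_closed invariant_poly.
Proof.
split=> [|f h /invariant_polyP fG /invariant_polyP hG
         |f h /invariant_polyP fG /invariant_polyP hG];
  apply/invariant_polyP => g gG; rewrite /linear_subst.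
- exact: rmorph1.
- by rewrite rmorphB /=; congr (_ - _); [exact: fG | exact: hG].
- rewrite rmorphM /=; congr (_ * _); first exact: fG.
  have [uh|nuh] := boolP (h \is a GRing.unit).
    by rewrite rmorphV //=; congr (_^-1); exact: hG.
  by rewrite invr_out //; exact: hG.
Qed.

HB.instance Definition _ :=
  GRing.isDivringClosed.Build {mpoly O[n]} invariant_poly
    invariant_poly_closed.

Record invariant_ring := InvariantRing {
  ir_val : {mpoly O[n]};
  ir_valP : ir_val \in invariant_poly }.

HB.instance Definition _ := [isSub for ir_val].
HB.instance Definition _ := [Choice of invariant_ring by <:].
HB.instance Definition _ := [SubChoice_isSubIntegralDomain of invariant_ring by <:].

End InvariantRing.

Section CommutativeAlgebra.

Definition is_max_nat (E : nat -> Prop) (d : nat) : Prop :=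
  E d /\ forall n, E n -> (n <= d)%N.

Section Ring.
Variable B : comNzRingType.

Definition gen_ideal (s : seq B) (x : B) : Prop :=
  exists c : nat -> B, x = \sum_(i < size s) c i * s`_i.

(* Only proper ideals are of type [idealr B]; the ring itself is (1). *)
Definition noetherian : Prop :=
  forall I : idealr B, exists s : seq B, forall x, x \in I <-> gen_ideal s x.

Definition maximal_ideal (m : prime_idealr B) : Prop :=
  forall I : idealr B, {subset m <= I} -> {subset I <= m}.

Definition prime_chain (n : nat) : Prop :=
  exists c : nat -> prime_idealr B, forall i, (i < n)%N ->
    {subset c i <= c i.+1} /\ ~ {subset c i.+1 <= c i}.

Definition krull_dim : nat -> Prop := is_max_nat prime_chain.

Definition regular_sequence (s : seq B) : Prop :=
  (forall i, (i < size s)%N -> forall x,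
     gen_ideal (take i s) (s`_i * x) -> gen_ideal (take i s) x)
  /\ ~ gen_ideal s 1.

Definition depth (m : idealr B) : nat -> Prop :=
  is_max_nat (fun n => exists s : seq B,
    [/\ size s = n, {subset s <= m} & regular_sequence s]).

End Ring.

Definition cohen_macaulay (B : idomainType) : Prop :=
  noetherian B /\
  forall m : prime_idealr B, maximal_ideal m ->
    exists d, krull_dim (localization m) d /\
              depth (localization_ideal m) d.

End CommutativeAlgebra.

Section Ramification.

Definition ideal_exp (B : comNzRingType) (I : {pred B}) (e : nat) (x : B) : Prop :=
  exists (n : nat) (c : 'I_n -> B) (y : 'I_n -> 'I_e -> B),
    (forall i j, y i j \in I) /\ x = \sum_i c i * \prod_j y i j.

(* For f : B -> C and a prime Q of C lying over q = f^-1(Q), the exponent of Q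
   in qC, that is, the e with qC contained in Q^e but not in Q^(e+1). *)
Definition ramification_index (B C : comNzRingType) (f : B -> C)
    (Q : prime_idealr C) (e : nat) : Prop :=
  (forall b, f b \in Q -> ideal_exp Q e (f b)) /\
  ~ (forall b, f b \in Q -> ideal_exp Q e.+1 (f b)).

Variables (K : fieldExtType rat) (L : splittingFieldType K).

Lemma algebraic_integer_in_alg (x : ring_of_integers K) :
  (val x)%:A \in algebraic_integer L.
Proof.
have /asboolP hx := valP x; apply/asboolP.
have [q q_monic q0] := integral_rmorph (in_alg L) hx.
exists q => //; congr (root _ _): q0; apply: eq_map_poly => k /=.
by rewrite -[_%:A]/(in_alg L _) rmorph_int.
Qed.

Definition integers_incl (x : ring_of_integers K) : ring_of_integers L :=
  Sub (val x)%:A (algebraic_integer_in_alg x).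

(* The residue fields are finite, so that residue extensions are separable. *)
Definition unramified_finite_places : Prop :=
  forall Q : prime_idealr (ring_of_integers L),
    (exists2 x, x \in Q & x != 0) -> ramification_index integers_incl Q 1.

(* Every embedding of L in the complex numbers (it takes algebraic values)
   that is real on K is real on L. *)
Definition unramified_infinite_places : Prop :=
  forall s : {rmorphism L -> algC},
    (forall x : K, s x%:A \is Num.real) -> forall y : L, s y \is Num.real.

Definition unramified_abelian : Prop :=
  [/\ galois 1%AS {:L}%AS, abelian 'Gal({:L}%AS / 1%AS),
      unramified_finite_places & unramified_infinite_places].

End Ramification.

(* Maximality is up to K-embedding, there being no ambient algebraic closure. *)
Definition hilbert_class_field (K : fieldExtType rat)
    (H : splittingFieldType K) : Prop :=
  unramified_abelian H /\
  forall M : splittingFieldType K, unramified_abelian M ->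
    exists f : 'Hom(M, H), ahom_in {:M} f.

(* Main.v *)
(* Unramifiedness of the Hilbert class field makes lam = zeta_p - 1 a
   uniformizer of the discrete valuation ring O = A_P. For g in G write
   g = 1 + lam X. If g ^ p = 1, then the factors of
   prod_(0 <= i < p) (g - zeta_p ^ i) = 0 show that g = 1 as soon as lam^2
   divides g - 1, so G is abelian of exponent p, and that X is killed by a
   polynomial split with roots distinct modulo lam. Hence O ^ 3 is the direct
   sum of common eigenspaces of G, and G is diagonalizable over O.

   The invariant ring A of a diagonal group is spanned by monomials, so it is
   a direct summand, as A-module, of O[X, Y, Z], and it contains the N-th
   powers of the variables for N = #|G|. A maximal ideal m of A has a finite
   residue extension over that of O (Zariski's lemma), which gives polynomials
   f_i with f_i(X_i ^ N) in m; together with lam, if it lies in m, they form a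
   regular sequence. Its length bounds the height of m from below, because a
   regular sequence gives a chain of primes avoiding multiplicative sets, and
   the algebraic dependence of any four elements of O[X, Y, Z] bounds the
   height from above by the same number. *)
Require Import Defs.
From HB Require Import structures.
From mathcomp Require Import all_boot all_order all_algebra all_fingroup.
From mathcomp Require Import all_solvable all_field all_character.
From mathcomp Require Import boolp mpoly.
From mathcomp Require classical_sets.
From mathcomp Require Import ring zify.

Set Implicit Arguments.
Unset Strict Implicit.
Unset Printing Implicit Defensive.

Import GRing.Theory Num.Theory.
Import VectorInternalTheory.
Local Open Scope ring_scope.
Local Open Scope quotient_scope.

(** * Regular sequences and chains of primes *)

(** Unramifiedness is used through one element: an algebraic integer beta of K = Q(zeta_p) lying in
    P but not in P^2. As [K : Q] < p, the powers 1, beta, ..., beta^(p-1) satisfy an integer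
    relation not divisible by p. Since p is a unit times lam^(p-1), comparing valuations in this
    relation excludes lam from P^2 A_P. That P A_P is principal in the first place rests on the
    finiteness of A / p and on the integral closedness of A.

    The f_i have leading coefficients outside m, so that the f_i(X_i ^ N) form a regular sequence
    once the constants outside m are inverted; hence the notion of weak regularity.

    For the height, an algebraic relation over O may have all its coefficients divisible by lam. Its
    content is removed at the step where a chain of primes meets lam, and that step accounts for the
    one extra dimension. *)

Section GeneratedIdeal.
Variable B : comNzRingType.
Implicit Types (I : B -> Prop) (s : seq B) (x y a : B).

Record is_ideal I : Prop := IsIdeal {
  ideal_0 : I 0;
  ideal_D : forall x y, I x -> I y -> I (x + y);
  ideal_M : forall a x, I x -> I (a * x) }.

Lemma ideal_N I x : is_ideal I -> I x -> I (- x).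
Proof. by move=> hI /(ideal_M hI (-1)); rewrite mulN1r. Qed.

Lemma ideal_B I x y : is_ideal I -> I x -> I y -> I (x - y).
Proof. by move=> hI hx /(ideal_N hI); exact: ideal_D. Qed.

Lemma ideal_sum I (T : Type) (r : seq T) (P : pred T) (F : T -> B) :
  is_ideal I -> (forall i, P i -> I (F i)) -> I (\sum_(i <- r | P i) F i).
Proof. by case=> h0 hD _ hF; exact: (big_ind I). Qed.

Lemma gen_ideal_ideal s : is_ideal (gen_ideal s).
Proof.
split.
- by exists (fun=> 0); rewrite big1 // => i _; rewrite mul0r.
- move=> x y [c ->] [d ->]; exists (fun i => c i + d i).
  by rewrite -big_split; apply: eq_bigr => i _; rewrite mulrDl.
- move=> a x [c ->]; exists (fun i => a * c i).
  by rewrite mulr_sumr; apply: eq_bigr => i _; rewrite mulrA.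
Qed.

Lemma gen_ideal_mem s x : x \in s -> gen_ideal s x.
Proof.
move=> xs; have ltx : (index x s < size s)%N by rewrite index_mem.
exists (fun i => (i == index x s)%:R).
rewrite (bigD1 (Ordinal ltx)) //= eqxx mul1r nth_index // big1 ?addr0 // => i.
by rewrite -val_eqE /= => /negPf->; rewrite mul0r.
Qed.

Lemma gen_ideal_min s I x :
  is_ideal I -> {in s, forall y, I y} -> gen_ideal s x -> I x.
Proof.
move=> hI hs [c ->]; apply: ideal_sum => // i _; apply: ideal_M => //.
by apply: hs; rewrite mem_nth.
Qed.

Lemma gen_ideal_sub s t x :
  {subset s <= t} -> gen_ideal s x -> gen_ideal t x.
Proof.
move=> st; apply: gen_ideal_min (gen_ideal_ideal t) _.
by move=> y /st; exact: gen_ideal_mem.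
Qed.

Lemma gen_ideal_nil x : gen_ideal [::] x <-> x = 0.
Proof.
by split=> [[c ->]|->]; [rewrite big_ord0 | exact: ideal_0 (gen_ideal_ideal _)].
Qed.

Lemma idealr_is_ideal (m : idealr B) : is_ideal (fun x => x \in m).
Proof. by split=> [|x y|a x]; [exact: rpred0|exact: rpredD|exact: idealMr]. Qed.

End GeneratedIdeal.

Lemma gen_ideal_map (B C : comNzRingType) (f : {rmorphism B -> C})
    (s : seq B) (x : B) :
  gen_ideal s x -> gen_ideal (map f s) (f x).
Proof.
move=> [c ->]; exists (f \o c); rewrite size_map rmorph_sum.
by apply: eq_bigr => i _ /=; rewrite rmorphM (nth_map 0).
Qed.

Section PrimeAvoidingMultiplicativeSet.
Variables (B : comNzRingType) (I S : B -> Prop).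
Hypotheses (hI : is_ideal I) (S1 : S 1).
Hypothesis SM : forall x y, S x -> S y -> S (x * y).
Hypothesis IS : forall x, I x -> ~ S x.

Let good (J : B -> Prop) :=
  [/\ is_ideal J, forall x, I x -> J x & forall x, J x -> ~ S x].

Let goodI : good I. Proof. by split. Qed.

(** Zorn's lemma: a nonempty chain is bounded by its union, the empty one by [I]. *)
Lemma exists_maximal_avoiding : exists J, good J /\
  forall J', good J' -> (forall x, J x -> J' x) -> forall x, J' x -> J x.
Proof.
pose T := {J : B -> Prop | good J}.
pose R (s t : T) := `[< forall x, sval s x -> sval t x >].
have [||| J Jmax] := @classical_sets.ZL_preorder T (exist _ I goodI) R.
- by move=> t; apply/asboolP.
- move=> r s t /asboolP rs /asboolP st; apply/asboolP => x /rs; exact: st.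
- move=> F totF; have [[t0 Ft0]|noF] := pselect (exists t, F t); last first.
    by exists (exist _ I goodI) => s Fs; case: noF; exists s.
  pose U x := exists2 t : T, F t & sval t x.
  have goodU : good U.
    split; first split.
    - by exists t0 => //; have [hJ _ _] := svalP t0; exact: ideal_0.
    - move=> x y [s Fs sx] [t Ft ty].
      have [/asboolP st|/asboolP ts] := totF _ _ Fs Ft.
        exists t => //; have [hJ _ _] := svalP t; apply: ideal_D => //.
        exact: st.
      exists s => //; have [hJ _ _] := svalP s; apply: ideal_D => //.
      exact: ts.
    - move=> a x [s Fs sx]; exists s => //.
      by have [hJ _ _] := svalP s; exact: ideal_M.
    - by move=> x Ix; exists t0 => //; have [_ hJ _] := svalP t0; exact: hJ.
    - by move=> x [s Fs sx]; have [_ _ hJ] := svalP s; exact: hJ.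
  exists (exist _ U goodU) => s Fs; apply/asboolP => x sx; by exists s.
- exists (sval J); split; first exact: svalP.
  move=> J' gJ' JJ'; suff /asboolP : R (exist _ J' gJ') J by [].
  by apply: Jmax; apply/asboolP.
Qed.

(** An ideal [J] maximal among those disjoint from [S] is prime: for [u], [v] outside [J], both J +
    (u) and J + (v) meet [S], and the product of the two elements found lies in J + (uv). *)
Lemma exists_prime_avoiding : exists q : prime_idealr B,
  (forall x, I x -> x \in q) /\ (forall x, x \in q -> ~ S x).
Proof.
have [J [[hJ IJ JS] Jmax]] := exists_maximal_avoiding.
pose q : {pred B} := fun x => `[< J x >].
have q_ideal : idealr_closed q.
  split; first by apply/asboolP; exact: ideal_0.
    by apply/asboolPn => /JS.
  move=> a x y /asboolP Jx /asboolP Jy; apply/asboolP.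
  by apply: ideal_D => //; exact: ideal_M.
(* By maximality the ideal J + (x), here [J'], meets [S]. *)
have adj x : ~ J x -> exists2 s, S s & exists c, J (s - c * x).
  move=> nJx; apply: contrapT => noS; apply: nJx.
  pose J' y := exists c, J (y - c * x).
  have gJ' : good J'.
    split; first split.
    - by exists 0; rewrite mul0r subr0; exact: ideal_0.
    - move=> y z [c hc] [d hd]; exists (c + d).
      by rewrite mulrDl opprD addrACA; exact: ideal_D.
    - move=> a y [c hc]; exists (a * c).
      by rewrite -mulrA -mulrBr; exact: ideal_M.
    - by move=> y /IJ Jy; exists 0; rewrite mul0r subr0.
    - by move=> y [c hc] Sy; apply: noS; exists y => //; exists c.
  apply: (Jmax _ gJ').
    by move=> y Jy; exists 0; rewrite mul0r subr0.
  by exists 1; rewrite mul1r subrr; exact: ideal_0.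
have q_prime : prime_idealr_closed q.
  move=> u v /asboolP Juv.
  apply: contrapT => /negP; rewrite negb_or => /andP[/asboolPn hu /asboolPn hv].
  have [s Ss [c hc]] := adj _ hu; have [t St [d hd]] := adj _ hv.
  apply: (JS (s * t)); last exact: SM.
  have -> : s * t = (s - c * u) * t + c * u * (t - d * v) + (c * d) * (u * v).
    rewrite mulrBl mulrBr addrA subrK.
    by rewrite [c * d * _]mulrACA subrK.
  apply: (ideal_D hJ); last exact: (ideal_M hJ).
  apply: (ideal_D hJ); last exact: (ideal_M hJ).
  by rewrite mulrC; exact: (ideal_M hJ).
pose m1 := isIdealr.Build B q q_ideal.
pose m2 := isPrimeIdealrClosed.Build B q q_prime.
pose Q : prime_idealr B := HB.pack q m1 m2.
by exists Q; split=> x; [move=> /IJ Jx; apply/asboolP | move=> /asboolP/JS].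
Qed.

End PrimeAvoidingMultiplicativeSet.

(* Going down one step from a prime q containing s_1, ..., s_(i+1): a prime
   over (s_1, ..., s_i) avoiding all t s_(i+1)^k with t outside q is contained
   in q and misses s_(i+1); such products avoid the ideal by regularity. *)
Lemma regular_sequence_prime_chain (B : comNzRingType) (s : seq B) :
  regular_sequence s -> prime_chain B (size s).
Proof.
move=> [reg s1].
have [q0 [sq0 _]] : exists q : prime_idealr B,
    (forall x, gen_ideal s x -> x \in q) /\ (forall x, x \in q -> ~ (x = 1)).
  apply: (exists_prime_avoiding (gen_ideal_ideal s)) => //.
    by move=> x y -> ->; rewrite mul1r.
  by move=> x sx x1; apply: s1; rewrite -x1.
(* The chain grows at its bottom: after [k] steps its smallest prime contains the first [size s - k]
   elements. *)
suff chain k : (k <= size s)%N -> exists c : nat -> prime_idealr B,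
    (forall x, gen_ideal (take (size s - k) s) x -> x \in c 0) /\
    forall i, (i < k)%N -> {subset c i <= c i.+1} /\ ~ {subset c i.+1 <= c i}.
  by have [c [_ hc]] := chain _ (leqnn _); exists c.
elim: k => [_|k IH ltk].
  by exists (fun=> q0); split=> // x; rewrite subn0 take_size; exact: sq0.
have [c [c0 hc]] := IH (ltnW ltk).
pose j := (size s - k.+1)%N.
have jk : (size s - k)%N = j.+1 by rewrite /j subnSK.
have ltj : (j < size s)%N by rewrite /j ltn_subrL (leq_ltn_trans _ ltk).
rewrite jk (take_nth 0 ltj) in c0.
pose S x := exists t n, t \notin c 0 /\ x = t * s`_j ^+ n.
have [q [Iq qS]] : exists q : prime_idealr B,
    (forall x, gen_ideal (take j s) x -> x \in q) /\
    (forall x, x \in q -> ~ S x).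
  apply: (exists_prime_avoiding (gen_ideal_ideal _)).
  - by exists 1, 0%N; rewrite idealr1 mulr1.
  - move=> _ _ [t [n [tq ->]]] [u [l [uq ->]]]; exists (t * u), (n + l)%N.
    by rewrite prime_idealrM negb_or tq uq exprD mulrACA.
  - move=> x Ix [t [n [tq xE]]]; rewrite {x}xE in Ix; case/negP: tq.
    apply: c0; apply: (gen_ideal_sub (s := take j s)).
      by move=> y; rewrite mem_rcons inE => ->; rewrite orbT.
    elim: n Ix => [|n IHn]; first by rewrite mulr1.
    by rewrite exprS mulrCA => /(reg _ ltj).
exists (fun i => if i is i'.+1 then c i' else q); split=> // [[_|i]]; last exact: hc.
split=> [x xq|sub].
  apply: contrapT => /negP xc; apply: (qS _ xq).
  by exists x, 0%N; rewrite mulr1.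
apply: (qS s`_j).
  by apply/sub/c0/gen_ideal_mem; rewrite mem_rcons mem_head.
by exists 1, 1%N; rewrite idealr1 mul1r.
Qed.

(** * Localization at a prime *)

Section LocalizationTheory.
Variables (A : idomainType) (m : prime_idealr A).

Lemma tofrac_in_localization (a : A) : tofrac a \in localization_pred m.
Proof.
by apply/asboolP; exists a, 1; rewrite notin_prime1 tofrac1 divr1.
Qed.

Definition loc (a : A) : localization m := Sub (tofrac a) (tofrac_in_localization a).

Lemma loc_is_zmod_morphism : zmod_morphism loc.
Proof. by move=> a b; apply: val_inj; rewrite raddfB /= raddfB. Qed.

Lemma loc_is_monoid_morphism : monoid_morphism loc.
Proof.
split; first by apply: val_inj; rewrite rmorph1 /= tofrac1.
by move=> a b; apply: val_inj; rewrite rmorphM /= rmorphM.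
Qed.

HB.instance Definition _ :=
  GRing.isZmodMorphism.Build A (localization m) loc loc_is_zmod_morphism.
HB.instance Definition _ :=
  GRing.isMonoidMorphism.Build A (localization m) loc loc_is_monoid_morphism.

Lemma loc_inj : injective loc.
Proof.
by move=> a b /(congr1 val); rewrite /= => /eqP; rewrite tofrac_eq => /eqP.
Qed.

Lemma locP (x : localization m) :
  exists a s, s \notin m /\ loc s * x = loc a.
Proof.
have /asboolP[a [s [hs xE]]] := sd_valP x; exists a, s; split=> //.
apply: val_inj; rewrite rmorphM /= xE.
by rewrite mulrC divfK // (tofrac_notin hs).
Qed.

Lemma loc_unit s : s \notin m -> loc s \is a GRing.unit.
Proof.
move=> hs; have sV : (tofrac s)^-1 \in localization_pred m.
  by apply/asboolP; exists 1, s; rewrite tofrac1 div1r.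
apply/unitrPr; exists (SubDomain sV : localization m); apply: val_inj.
by rewrite rmorphM rmorph1 /= mulfV // (tofrac_notin hs).
Qed.

Lemma localization_idealP (x : localization m) :
  reflect (exists a s, [/\ a \in m, s \notin m & loc s * x = loc a])
          (x \in localization_ideal m).
Proof.
apply: (iffP idP) => [/asboolP[a [s [ha hs xE]]]|[a [s [ha hs xE]]]].
  exists a, s; split=> //; apply: val_inj.
  by rewrite rmorphM /= xE mulrC divfK // (tofrac_notin hs).
apply/asboolP; exists a, s; split=> //.
move: xE => /(congr1 val); rewrite rmorphM /= => <-.
by rewrite mulrC mulKf // (tofrac_notin hs).
Qed.

Lemma loc_in_ideal a : (loc a \in localization_ideal m) = (a \in m).
Proof.
apply/localization_idealP/idP => [[b [s [hb hs]]]|am]; last first.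
  by exists a, 1; rewrite notin_prime1 rmorph1 mul1r.
rewrite -rmorphM => /loc_inj sab.
by move: hb; rewrite -sab prime_idealrM (negPf hs).
Qed.

Lemma unit_of_notin_localization_ideal (x : localization m) :
  x \notin localization_ideal m -> x \is a GRing.unit.
Proof.
have [a [s [hs xE]]] := locP x => xm.
have am : a \notin m.
  by apply: contra xm => am; apply/localization_idealP; exists a, s.
by move: (loc_unit am); rewrite -xE unitrM => /andP[].
Qed.

(** The extended ideal consists of the fractions z / t with z in (s) and t outside [m]; the
    predicate [I] of the proof is this description. *)
Lemma gen_ideal_loc (s : seq A) (x : A) :
  gen_ideal (map loc s) (loc x) <-> exists2 t, t \notin m & gen_ideal s (t * x).
Proof.
split=> [|[t tm hx]]; last first.
  rewrite -[loc x](mulKr (loc_unit tm)) -rmorphM.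
  by apply: (ideal_M (gen_ideal_ideal _)); exact: gen_ideal_map.
pose I (y : localization m) := exists t z,
  [/\ t \notin m, gen_ideal s z & loc t * y = loc z].
have hI : is_ideal I.
  have hs := gen_ideal_ideal s; split.
  - exists 1, 0; rewrite notin_prime1 mulr0 rmorph0; split=> //.
    exact: ideal_0.
  - move=> y z [t [a [tm ha ta]]] [u [b [um hb ub]]].
    exists (t * u), (u * a + t * b); split; first exact: notin_primeM.
      by apply: ideal_D => //; exact: ideal_M.
    rewrite [RHS](rmorphD loc) !(rmorphM loc) /= -ta -ub.
    by rewrite mulrDr -!(mulrA (loc t)) (mulrCA (loc t) (loc u) y).
  - move=> c y [t [a [tm ha ta]]]; have [d [u [um ud]]] := locP c.
    exists (u * t), (d * a); split; [exact: notin_primeM|exact: ideal_M|].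
    by rewrite [loc (d * a)]rmorphM [loc (u * t)]rmorphM /= -ta -ud mulrACA.
move=> /(gen_ideal_min hI)[].
  by move=> _ /mapP[a sa ->]; exists 1, a;
    rewrite notin_prime1 rmorph1 mul1r; split=> //; exact: gen_ideal_mem.
move=> t [z [tm hz]]; rewrite -rmorphM => /loc_inj txz.
by exists t; rewrite ?txz.
Qed.

End LocalizationTheory.

(** Stated for plain predicates, so that contracted primes and the zero ideal can be put into one
    chain. *)
Record is_prime (B : comNzRingType) (q : B -> Prop) : Prop := IsPrime {
  prime_ideal :> is_ideal q;
  prime_1 : ~ q 1;
  prime_M : forall x y, q (x * y) -> q x \/ q y }.

Lemma prime_X (B : comNzRingType) (q : B -> Prop) x k :
  is_prime q -> q (x ^+ k) -> q x.
Proof.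
move=> hq; elim: k => [/(prime_1 hq)//|k IH].
by rewrite exprS => /(prime_M hq)[].
Qed.

Lemma prime_unit (B : comUnitRingType) (q : B -> Prop) u :
  is_prime q -> u \is a GRing.unit -> ~ q u.
Proof. by move=> hq uu /(ideal_M hq u^-1); rewrite mulVr //; exact: prime_1. Qed.

Lemma prime_idealr_is_prime (B : comNzRingType) (m : prime_idealr B) :
  is_prime (fun x => x \in m).
Proof.
split; first exact: idealr_is_ideal.
  by rewrite idealr1.
by move=> x y; rewrite prime_idealrM => /orP.
Qed.

(** This says that [O] is a discrete valuation ring with uniformizer [pi]; the factorization stands
    in for the valuation. *)
Definition is_uniformizer (O : idomainType) (pi : O) : Prop :=
  [/\ pi != 0, pi \isn't a GRing.unit &
      forall a, a != 0 -> exists u k, u \is a GRing.unit /\ a = u * pi ^+ k].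

(** * Upper bound on the length of prime chains *)

Section Evaluation.
Variables (O A : comNzRingType) (c : {rmorphism O -> A}) (N : nat).

(* The value at [l] of the polynomial of degree < [N] in each variable whose
   coefficient at the exponent vector [e] is [f e]. *)
Fixpoint ev (l : seq A) (f : seq nat -> O) : A :=
  if l is b :: l' then \sum_(i < N) b ^+ i * ev l' (fun e => f (nat_of_ord i :: e))
  else c (f [::]).

Definition exponent (l : seq A) (e : seq nat) : bool :=
  (size e == size l) && all (fun i => i < N)%N e.

(** Only says that the polynomial is nonzero; its vanishing at [l] is stated separately. *)
Definition nonzero_rel (l : seq A) (f : seq nat -> O) : Prop :=
  exists2 e, exponent l e & f e != 0.

Lemma eq_ev l f g : (forall e, exponent l e -> f e = g e) -> ev l f = ev l g.
Proof.
elim: l f g => [|b l IH] f g fg /=; first by rewrite fg.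
apply: eq_bigr => i _; congr (_ * _); apply: IH => e /andP[se ee].
by apply: fg; rewrite /exponent /= eqSS se ltn_ord.
Qed.

Lemma ev_eq0 l f : (forall e, exponent l e -> f e = 0) -> ev l f = 0.
Proof.
move=> f0; rewrite (eq_ev (g := fun=> 0)) //.
elim: l {f f0} => [|b l IH] /=; first exact: rmorph0.
by rewrite big1 // => i _; rewrite IH mulr0.
Qed.

(** Linearity in the shape that [ev_content] needs: a factor [a] pulled out of a main part and a
    remainder. *)
Lemma evDM l f g a b :
  ev l (fun e => a * (f e + b * g e)) = c a * (ev l f + c b * ev l g).
Proof.
elim: l f g => [|x l IH] f g /=; first by rewrite rmorphM rmorphD rmorphM.
rewrite mulr_sumr -big_split mulr_sumr; apply: eq_bigr => i _ /=.
by rewrite IH mulrCA; congr (_ * _); rewrite mulrDr (mulrCA _ (c b)).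
Qed.

(** Ordered by powers of [b], the value is b^i (g + b r), where [i] is the least index whose
    coefficient polynomial is nonzero. As [b] is outside the prime [q], g + b r lies in [q]; as [b]
    lies in [q'], so does g. *)
Lemma ev_step (q q' : A -> Prop) b l f :
  is_prime q -> is_ideal q' -> (forall x, q x -> q' x) -> ~ q b -> q' b ->
  nonzero_rel (b :: l) f -> q (ev (b :: l) f) ->
  exists i, (i < N)%N /\ let g := fun e => f (i :: e) in
    nonzero_rel l g /\ q' (ev l g).
Proof.
move=> hq hq' qq' qb q'b [[|i0 e0]] /andP[//] se0 /andP[lt0 ee0] f0 evq.
have ex_i : exists i, (i < N)%N && `[< nonzero_rel l (fun e => f (i :: e)) >].
  exists i0; rewrite lt0; apply/asboolP; exists e0 => //.
  by rewrite /exponent -eqSS se0.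
case: (ex_minnP ex_i) => i /andP[lti /asboolP nzi] mini.
exists i; split=> //=; split=> //.
suff /(prime_M hq)[/(prime_X hq)//|h] :
    q (b ^+ i * (ev l (fun e => f (i :: e)) +
        b * \sum_(i.+1 <= j < N) b ^+ (j - i.+1) * ev l (fun e => f (j :: e)))).
  set r := (\sum_(_ <= _ < _) _) in h.
  rewrite -(addrK (b * r) (ev l _)); apply: (ideal_B hq'); first exact: qq'.
  by rewrite mulrC; exact: ideal_M.
move: evq; rewrite /= -(big_mkord xpredT
  (fun j => b ^+ j * ev l (fun e => f (j :: e)))).
rewrite (big_cat_nat (n := i)) //=; last exact: ltnW.
rewrite big_nat big1 ?add0r => [|j /= ltji]; last first.
  rewrite ev_eq0 ?mulr0 // => e he; apply/eqP; apply: contraTT ltji => fje.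
  rewrite -leqNgt; have [ltjN|leNj] := ltnP j N; last exact: leq_trans (ltnW lti) _.
  by apply: mini; rewrite ltjN; apply/asboolP; exists e.
rewrite big_ltn // mulrDr; congr (q (_ + _)).
rewrite !mulr_sumr big_nat [RHS]big_nat; apply: eq_bigr => j /andP[ltij _].
by rewrite mulrA -exprSr mulrA -exprD subnKC.
Qed.

(** Each step of the chain removes one variable, by means of an element that enters the prime at
    that step. *)
Lemma ev_chain (p : nat -> A -> Prop) l1 l2 f :
  (forall i, (i <= size l1)%N -> is_prime (p i)) ->
  (forall i, (i < size l1)%N -> (forall x, p i x -> p i.+1 x) /\
     ~ p i l1`_i /\ p i.+1 l1`_i) ->
  nonzero_rel (l1 ++ l2) f -> p 0 (ev (l1 ++ l2) f) ->
  exists2 e1, exponent l1 e1 & let g := fun e => f (e1 ++ e) in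
    nonzero_rel l2 g /\ p (size l1) (ev l2 g).
Proof.
elim: l1 p f => [|b l1 IH] p f pp pl nzf evf; first by exists [::].
have [p01 [pb p'b]] := pl 0 isT.
have [i [lti [nzi evi]]] := ev_step (pp 0 isT) (pp 1 isT) p01 pb p'b nzf evf.
have [||e1 ee1 he1] := IH (fun i => p i.+1) _ _ _ nzi evi.
- by move=> j lej; exact: pp.
- by move=> j ltj; exact: pl.
exists (i :: e1) => //.
by move: ee1; rewrite /exponent /= eqSS lti.
Qed.

End Evaluation.

(** Algebraic dependence over [O]; all the coefficients of the relation may be nonunits. *)
Definition dependent (O A : comNzRingType) (c : {rmorphism O -> A})
    (l : seq A) : Prop :=
  exists N f, nonzero_rel N l f /\ ev c N l f = 0.

Section ChainBound.
Variables (O A : idomainType) (pi : O) (c : {rmorphism O -> A}) (d : nat).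
Hypothesis hpi : is_uniformizer pi.
Hypothesis c_inj : injective c.
Hypothesis dep : forall l : seq A, size l = d.+1 -> dependent c l.

(** [s] is the least valuation of a coefficient. The coefficients of valuation exactly [s] become
    the units of [g], and the others go into the remainder [r]. *)
Lemma ev_content N (l : seq A) (f : seq nat -> O) : nonzero_rel N l f ->
  exists s g r, [/\ nonzero_rel N l g,
    forall e, exponent N l e -> g e != 0 -> g e \is a GRing.unit &
    ev c N l f = c pi ^+ s * (ev c N l g + c pi * r)].
Proof.
have [pi0 piU dvr] := hpi; move=> [e0 he0 fe0].
have ex_s : exists s,
    `[< exists e u, [/\ exponent N l e, u \is a GRing.unit & f e = u * pi ^+ s] >].
  have [u [s [uU fE]]] := dvr _ fe0.
  by exists s; apply/asboolP; exists e0, u.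
case: (ex_minnP ex_s) => s /asboolP[e1 [u1 [he1 u1U fe1]]] mins.
have /choice[h hh] : forall e, exists gr : O * O, exponent N l e ->
    f e = pi ^+ s * (gr.1 + pi * gr.2) /\ (gr.1 != 0 -> gr.1 \is a GRing.unit).
  move=> e; have [fe|fe] := eqVneq (f e) 0.
    by exists (0, 0) => _ /=; rewrite mulr0 addr0 mulr0 eqxx.
  have [u [k [uU fE]]] := dvr _ fe.
  case: (ltngtP s k) => [ltsk|ltks|eqsk].
  - exists (0, u * pi ^+ (k - s.+1)) => _ /=; rewrite eqxx add0r; split=> //.
    by rewrite mulrA -exprSr mulrCA -exprD subnKC.
  - exists (0, 0) => he; suff: (s <= k)%N by rewrite leqNgt ltks.
    by apply: mins; apply/asboolP; exists e, u.
  - by exists (u, 0) => _ /=; rewrite mulr0 addr0 mulrC eqsk.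
exists s, (fun e => (h e).1), (ev c N l (fun e => (h e).2)); split.
- exists e1 => //; have [fe _] := hh _ he1; apply: contraNneq piU => h1.
  suff : u1 \is a GRing.unit by rewrite
    (mulIf (expf_neq0 s pi0) (etrans (esym fe1) (etrans fe (mulrC _ _))))
    h1 add0r unitrM => /andP[].
  by [].
- by move=> e /hh[_].
- rewrite -rmorphXn -evDM; apply: eq_ev => e /hh[-> _] //.
Qed.

Section Chain.
Variables (n : nat) (p : nat -> A -> Prop).
Hypothesis pp : forall i, (i <= n)%N -> is_prime (p i).
Hypothesis p_sub : forall i, (i < n)%N -> forall x, p i x -> p i.+1 x.
Hypothesis p_neq : forall i, (i < n)%N -> exists2 x, p i.+1 x & ~ p i x.

Lemma chain_sub i j x : (i <= j <= n)%N -> p i x -> p j x.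
Proof.
move=> /andP[]; elim: j => [|j IH]; first by rewrite leqn0 => /eqP->.
rewrite leq_eqVlt => /predU1P[<-//|leij ltj] px.
by apply: p_sub => //; exact: IH (ltnW ltj) px.
Qed.

(** With more than [d] steps, [d.+1] of them eliminate all variables of a relation and leave a
    nonzero constant in [p n]; being a unit times a power of [pi], it puts [pi] there. *)
Lemma chain_bound_generic : ~ p n (c pi) -> (n <= d)%N.
Proof.
move=> pn; rewrite leqNgt; apply/negP => ltdn.
have /choice[a ha] : forall i, exists x, (i < n)%N -> p i.+1 x /\ ~ p i x.
  move=> i; have [lti|lei] := ltnP i n; last by exists 0.
  by have [x ? ?] := p_neq lti; exists x.
have [N [f [nzf evf]]] := dep (size_mkseq a d.+1).
have szl := size_mkseq a d.+1.
have [||||e _ [[e' he' nz0] pd]] := @ev_chain O A c N p (mkseq a d.+1) [::] f;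
  rewrite ?cats0 ?szl //.
- by move=> i lei; apply: pp; exact: leq_trans lei _.
- move=> i lti; have ltin : (i < n)%N by exact: leq_trans ltdn.
  by rewrite nth_mkseq //; have [? ?] := ha _ ltin; split=> //; exact: p_sub.
- by rewrite evf; apply: ideal_0; exact: (pp (leq0n n)).
move: pd; rewrite szl => pd.
have {}pd : p n (c (f (e ++ [::]))) by apply: chain_sub pd; rewrite ltdn /=.
have e'E : e' = [::] by case: e' he' {nz0}.
rewrite e'E in nz0.
have [_ _ dvr] := hpi; have [u [k [uU fE]]] := dvr _ nz0.
move: pd; rewrite fE rmorphM rmorphXn => /(prime_M (pp (leqnn n)))[].
  by apply: prime_unit (pp (leqnn n)) _; exact: rmorph_unit.
by move/(prime_X (pp (leqnn n))).
Qed.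

(* The chain jumps over [pi] at step [j], so that only the other steps need an
   element of their own. *)
Lemma chain_bound_jump j : (j < n)%N -> ~ p j (c pi) -> p j.+1 (c pi) ->
  n <> d.+2.
Proof.
move=> ltjn pj pj1 nE; have ltjd : (j <= d.+1)%N by lia.
have /choice[a ha] : forall i, exists x, (i < n)%N -> p i.+1 x /\ ~ p i x.
  move=> i; have [lti|lei] := ltnP i n; last by exists 0.
  by have [x ? ?] := p_neq lti; exists x.
have sz1 := size_mkseq a j.
(* The index skips step [j], so the [d.+2] steps supply [d.+1] elements. *)
pose l2 := mkseq (fun i => a (i + j.+1)%N) (d.+1 - j).
have sz2 : size l2 = (d.+1 - j)%N by rewrite size_mkseq.
have [N [f [nzf evf]]] : dependent c (mkseq a j ++ l2).
  by apply: dep; rewrite size_cat sz1 sz2 subnKC.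
have [||||e _ [nze pe]] := @ev_chain O A c N p (mkseq a j) l2 f; rewrite ?sz1 //.
- by move=> i lei; apply: pp; lia.
- move=> i lti; have ltin : (i < n)%N by lia.
  by rewrite nth_mkseq //; have [? ?] := ha _ ltin; split=> //; exact: p_sub.
- by rewrite evf; apply: ideal_0; exact: (pp (leq0n n)).
move: pe; rewrite sz1; have [s [g [r [nzg gU ->]]]] := ev_content nze.
have pjP := pp (ltnW ltjn); have pj1P := pp ltjn.
move=> /(prime_M pjP)[/(prime_X pjP)//|/(p_sub ltjn) h].
have {}h : p j.+1 (ev c N l2 g).
  rewrite -[ev _ _ _ _](addrK (c pi * r)); apply: (ideal_B pj1P h).
  by rewrite mulrC; apply: (ideal_M pj1P).
have [||||e' he' [[e'' he'' nz0] pd]] :=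
  @ev_chain O A c N (fun i => p (i + j.+1)%N) l2 [::] g; rewrite ?cats0 ?sz2 //.
- by move=> i lei; apply: pp; lia.
- move=> i lti; have ltin : (i + j.+1 < n)%N by lia.
  by rewrite nth_mkseq //; have [? ?] := ha _ ltin; split=> //; exact: p_sub.
have {he''} eE : e'' = [::] by case: e'' he'' {nz0}.
rewrite {}eE in nz0; rewrite sz2 /= in pd.
have {}pd : p n (c (g (e' ++ [::]))) by apply: chain_sub pd; lia.
apply: prime_unit (pp (leqnn n)) _ pd; apply: rmorph_unit; apply: gU nz0.
by rewrite cats0.
Qed.

End Chain.

Lemma chain_bound (n : nat) (p : nat -> A -> Prop) :
  (forall i, (i <= n)%N -> is_prime (p i)) ->
  (forall i, (i < n)%N -> forall x, p i x -> p i.+1 x) ->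
  (forall i, (i < n)%N -> exists2 x, p i.+1 x & ~ p i x) ->
  (n <= d.+1)%N /\ (~ p n (c pi) -> (n <= d)%N).
Proof.
move=> pp p_sub p_neq; split; last exact: chain_bound_generic.
rewrite leqNgt; apply/negP => ltdn.
have [p0|p0] := pselect (p 0 (c pi)).
  (* When [pi] is already in the bottom prime, the zero ideal is put below it, so that [pi] enters
     at step 0. *)
  pose p' i := if i is i'.+1 then p i' else fun x : A => x = 0.
  have [pi0 _ _] := hpi.
  have := @chain_bound_jump d.+2 p' _ _ _ 0; apply=> //=; last first.
  - by move/eqP; rewrite -(rmorph0 c) (inj_eq c_inj) (negPf pi0).
  - move=> [_|i lti]; last by apply: p_neq; lia.
    by exists (c pi) => // /eqP; rewrite -(rmorph0 c) (inj_eq c_inj) (negPf pi0).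
  - move=> [_ x ->|i lti]; last by apply: p_sub; lia.
    exact: ideal_0 (pp _ _).
  - move=> [_|i lei]; last by apply: pp; lia.
    split; first split=> //.
    + by move=> x y -> ->; rewrite addr0.
    + by move=> a x ->; rewrite mulr0.
    + by apply/eqP; exact: oner_neq0.
    + by move=> x y /eqP; rewrite mulf_eq0 => /orP[]/eqP; [left|right].
have ltd2 : (d.+2 <= n)%N by [].
have pp' i : (i <= d.+2)%N -> is_prime (p i).
  by move=> lei; apply: pp; lia.
have ps' i : (i < d.+2)%N -> forall x, p i x -> p i.+1 x.
  by move=> lei; apply: p_sub; lia.
have pn' i : (i < d.+2)%N -> exists2 x, p i.+1 x & ~ p i x.
  by move=> lei; apply: p_neq; lia.
have [pd|pd] := pselect (p d.+2 (c pi)); last first.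
  by have := chain_bound_generic pp' ps' pn' pd; lia.
(* The first prime containing [pi] is not the bottom one, so [pi] enters the chain at a definite
   step. *)
have ex_j : exists j, `[< p j (c pi) >] by exists d.+2; apply/asboolP.
case: (ex_minnP ex_j) => -[|j] /asboolP pj minj //.
have ltj : (j < d.+2)%N by apply: minj; apply/asboolP.
apply: (chain_bound_jump pp' ps' pn' ltj _ pj) => // /asboolP/minj.
by rewrite ltnn.
Qed.

End ChainBound.

(** * Algebraic dependence in polynomial rings *)

Lemma fraction_num_den (O : idomainType) (x : {fraction O}) :
  exists n d : O, d != 0 /\ x = tofrac n / tofrac d.
Proof.
elim/quotW: x => r; exists (\n_r)%R, (\d_r)%R; split; first exact: denom_ratioP.
have d0 : tofrac \d_r != 0 :> {fraction O} by rewrite tofrac_eq0 denom_ratioP.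
apply: (mulIf d0); rewrite divfK //.
unlock tofrac; rewrite -[LHS]FracField.pi_mul.
apply/eqmodP; rewrite /= FracField.equivfE /FracField.mulf.
by rewrite !numden_Ratio ?(oner_eq0, mulf_neq0, denom_ratioP) // !mulr1 mulrC.
Qed.

Lemma common_denominator (O : idomainType) (T : finType) (F : T -> {fraction O}) :
  exists d (a : T -> O), d != 0 /\ forall i, tofrac d * F i = tofrac (a i).
Proof.
have /choice[nd hnd] : forall i, exists nd : O * O,
    nd.2 != 0 /\ F i = tofrac nd.1 / tofrac nd.2.
  by move=> i; have [n [d h]] := fraction_num_den (F i); exists (n, d).
exists (\prod_i (nd i).2), (fun i => (nd i).1 * \prod_(j | j != i) (nd j).2).
split; first by apply/prodf_neq0 => i _; have [] := hnd i.
move=> i; have [d0 ->] := hnd i; rewrite (bigD1 i) //= !rmorphM /=.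
by rewrite [X in X * _]mulrC mulrACA mulfV ?tofrac_eq0 // mulr1 mulrC.
Qed.

(** A kernel vector over the fraction field, multiplied by a common denominator. *)
Lemma left_kernel_nonzero (O : idomainType) (r s : nat) (M : 'M[O]_(r, s)) :
  (s < r)%N -> exists2 v : 'rV[O]_r, v != 0 & v *m M = 0.
Proof.
move=> ltsr; pose M' := map_mx (@tofrac O) M.
have : kermx M' != 0.
  rewrite kermx_eq0 /row_free neq_ltn; apply/orP; left.
  exact: leq_ltn_trans (rank_leq_col _) ltsr.
move=> /rowV0Pn[w /sub_kermxP wM w0].
have [d [a [d0 da]]] := common_denominator (fun i => w 0 i).
have wE : map_mx (@tofrac O) (\row_i a i) = tofrac d *: w.
  by apply/rowP => i; rewrite !mxE da.
exists (\row_i a i).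
  apply: contra w0 => /eqP a0; move: wE; rewrite a0 map_mx0 => /esym/eqP.
  by rewrite scaler_eq0 tofrac_eq0 (negPf d0).
have : map_mx (@tofrac O) (\row_i a i *m M) = 0.
  by rewrite map_mxM wE -scalemxAl wM scaler0.
move=> /rowP vM0; apply/rowP => j.
have := vM0 j; rewrite [LHS]mxE [RHS]mxE => /eqP; rewrite tofrac_eq0 => /eqP->.
by rewrite mxE.
Qed.

Section ExponentSum.
Variables (O A : comNzRingType) (c : {rmorphism O -> A}) (N : nat).

Fixpoint exponents (k : nat) : seq (seq nat) :=
  if k is k'.+1 then [seq i :: e | i <- iota 0 N, e <- exponents k'] else [:: [::]].

Fixpoint monomial_at (l : seq A) (e : seq nat) : A :=
  match l, e with b :: l', i :: e' => b ^+ i * monomial_at l' e' | _, _ => 1 end.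

Lemma size_exponents k : size (exponents k) = (N ^ k)%N.
Proof. by elim: k => //= k IH; rewrite size_allpairs size_iota IH expnS. Qed.

Lemma uniq_exponents k : uniq (exponents k).
Proof.
elim: k => //= k IH; apply: allpairs_uniq => //; first exact: iota_uniq.
by move=> [i e] [j f] _ _ /= [-> ->].
Qed.

Lemma mem_exponents (l : seq A) e : e \in exponents (size l) -> exponent N l e.
Proof.
elim: l e => [|b l IH] e /=; first by rewrite inE => /eqP->.
case/allpairsP => -[i f] /= [+ /IH /andP[sf ef] ->].
by rewrite mem_iota /exponent /= eqSS sf ef => ->.
Qed.

(** Flattening the nested evaluation turns the search for a relation into that for a left kernel
    vector. *)
Lemma ev_sum (l : seq A) f :
  ev c N l f = \sum_(e <- exponents (size l)) c (f e) * monomial_at l e.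
Proof.
elim: l f => [|b l IH] f; first by rewrite big_seq1 mulr1.
rewrite /= big_allpairs_dep -(big_mkord xpredT
  (fun i => b ^+ i * ev c N l (fun e => f (i :: e)))).
rewrite /index_iota subn0; apply: eq_bigr => i _.
by rewrite IH mulr_sumr; apply: eq_bigr => e _; rewrite mulrCA.
Qed.

End ExponentSum.

Section Dependence.
Variables (O : idomainType) (n : nat).
Local Notation R := {mpoly O[n]}.

Lemma msizeM_leP (p q : R) : (msize (p * q) <= (msize p + msize q).-1)%N.
Proof.
have [->|p0] := eqVneq p 0; first by rewrite mul0r msize0.
have [->|q0] := eqVneq q 0; first by rewrite mulr0 msize0.
by rewrite msizeM.
Qed.

Lemma msizeX_le (b : R) D k : (msize b <= D.+1)%N -> (msize (b ^+ k) <= (k * D).+1)%N.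
Proof.
move=> leb; elim: k => [|k IH]; first by rewrite expr0 msize1.
rewrite exprS mulSn; apply: leq_trans (msizeM_leP _ _) _.
by move: IH leb; set x := msize _; set y := msize _; lia.
Qed.

Lemma msize_monomial_at (l : seq R) N D e : exponent N l e ->
  {in l, forall b, msize b <= D.+1}%N ->
  (msize (monomial_at l e) <= (size l * (N * D)).+1)%N.
Proof.
elim: l e => [|b l IH] [|i e] //=; rewrite ?msize1 // /exponent /=.
rewrite eqSS => /and3P[se lti ee] hl.
apply: leq_trans (msizeM_leP _ _) _.
have := IH e; rewrite /exponent se ee => /(_ isT) {}IH.
have {}IH := IH (fun x xl => hl x (mem_behead (s := b :: l) xl)).
have hb := msizeX_le i (hl b (mem_head _ _)).
have leiN : (i * D <= N * D)%N by rewrite leq_mul2r ltnW ?orbT.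
by move: IH hb leiN; rewrite mulSn; set x := msize _; set y := msize _; lia.
Qed.

Lemma card_bmultinom_le k : (#|{: 'X_{1..n < k}}| <= k ^ n)%N.
Proof.
rewrite -[X in (X ^ _)%N]card_ord -[X in (_ ^ X)%N]card_ord -card_ffun.
have lt_mk (m : 'X_{1..n < k}) i : (m i < k)%N.
  by apply: leq_ltn_trans (bmdeg m); rewrite mdegE (bigD1 i) //= leq_addr.
pose f (m : 'X_{1..n < k}) : {ffun 'I_n -> 'I_k} := [ffun i => Ordinal (lt_mk m i)].
apply: (@leq_card _ _ f) => m1 m2 /ffunP m12; apply/val_inj/mnmP => i.
by have := m12 i; rewrite !ffunE => /(congr1 val).
Qed.

(* With exponents below [N] there are [N ^ n.+1] monomials in the elements of
   [l], all in the span of at most [(N * C) ^ n] monomials in the variables. *)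
Lemma mpoly_dependent (l : seq R) : size l = n.+1 -> dependent (@mpolyC n O) l.
Proof.
move=> sl; pose D := (\max_(b <- l) msize b)%N.
have leD : {in l, forall b, msize b <= D.+1}%N.
  by move=> b bl; apply/leqW; rewrite /D; apply: leq_bigmax_seq.
(* With these constants [k] is at most N C, so there are at most N^n C^n columns; as N exceeds C^n,
   this is less than the N^(n+1) rows. *)
pose C := (n.+1 * D).+1; pose N := (C ^ n).+1.
pose k := (n.+1 * (N * D)).+1.
pose ex := exponents N n.+1.
pose M : 'M[O]_(size ex, #|{: 'X_{1..n < k}}|) :=
  \matrix_(i, j) (monomial_at l (nth [::] ex i))@_(enum_val j : 'X_{1..n < k}).
have ltM : (#|{: 'X_{1..n < k}}| < size ex)%N.
  rewrite size_exponents; apply: leq_ltn_trans (card_bmultinom_le _) _.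
  have lek : (k <= N * C)%N.
    by rewrite /k /C mulnS mulnCA -add1n leq_add2r.
  apply: (@leq_ltn_trans ((N * C) ^ n)); last first.
    by rewrite expnMn expnSr ltn_pmul2l ?expn_gt0.
  by case: (n) => // n'; rewrite leq_exp2r.
have [v v0 vM] := left_kernel_nonzero M ltM.
pose g e := if insub (index e ex) is Some i then v 0 i else 0.
have gE (i : 'I_(size ex)) : g (nth [::] ex i) = v 0 i.
  by rewrite /g index_uniq ?uniq_exponents // valK.
exists N, g; split.
  have [i vi] : exists i, v 0 i != 0.
    by apply/rV0Pn.
  exists (nth [::] ex i); last by rewrite gE.
  by apply: mem_exponents; rewrite sl mem_nth.
rewrite ev_sum sl -/ex (big_nth [::]) big_mkord; apply/mpolyP => m.
rewrite mcoeff0 raddf_sum /=.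
have [ltm|lem] := ltnP (mdeg m) k.
  have /rowP/(_ (enum_rank (BMultinom ltm))) := vM; rewrite !mxE => {2}<-.
  by apply: eq_bigr => i _; rewrite mxE enum_rankK gE mcoeffCM.
rewrite big1 // => i _; rewrite mcoeffCM [X in _ * X](_ : _ = 0) ?mulr0 //.
apply/eqP; rewrite mcoeff_eq0; apply: msize_mdeg_ge; apply: leq_trans lem.
rewrite /k -sl; apply: msize_monomial_at => //.
by apply: mem_exponents; rewrite sl mem_nth.
Qed.

End Dependence.

Lemma dependent_inj (O A B : comNzRingType) (c : {rmorphism O -> A})
    (c' : {rmorphism O -> B}) (f : {rmorphism A -> B}) (l : seq A) :
  injective f -> (forall a, f (c a) = c' a) ->
  dependent c' (map f l) -> dependent c l.
Proof.
move=> f_inj fc [N [g [[e he ge] evg]]]; exists N, g; split.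
  by exists e => //; move: he; rewrite /exponent size_map.
apply: f_inj; rewrite rmorph0 -evg {he evg}.
elim: l g {ge} => [|b l IH] g /=; first exact: fc.
by rewrite rmorph_sum; apply: eq_bigr => i _; rewrite rmorphM rmorphXn /= IH.
Qed.

(** * Integrality and Zariski's lemma *)

Section Integrality.
Variables (R : comNzRingType) (E : fieldType) (phi : {rmorphism R -> E}).

Lemma integral_exp y n : integralOver phi y -> integralOver phi (y ^+ n).
Proof.
move=> hy; elim: n => [|n IH]; first exact: integral1.
by rewrite exprS; exact: integral_mul.
Qed.

(** [phi] may kill leading coefficients; truncating at the size of the image makes the leading
    coefficient survive. *)
Lemma trim_poly (q : {poly R}) : map_poly phi q != 0 ->
  exists2 q', map_poly phi q' = map_poly phi q & phi (lead_coef q') != 0.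
Proof.
move=> q0; pose n := size (map_poly phi q); exists (take_poly n q).
  apply/polyP => i; rewrite !coef_map coef_take_poly.
  by case: ltnP => // lei; rewrite raddf0 -coef_map nth_default.
have n0 : (0 < n)%N by rewrite size_poly_gt0.
have cn : phi (take_poly n q)`_n.-1 != 0.
  by rewrite coef_take_poly prednK // leqnn -coef_map -lead_coefE lead_coef_eq0.
have sn : size (take_poly n q) = n.
  apply/eqP; rewrite eqn_leq size_take_poly /=.
  rewrite leqNgt; apply: contra cn => ltn.
  by rewrite nth_default ?rmorph0 // -ltnS prednK.
by rewrite lead_coefE sn.
Qed.

(** [t * y] is a root of the monic polynomial with coefficients t^(n-i) p_i, which are integral by
    assumption. *)
Lemma integral_scale (t y : E) (p : {poly E}) : p \is monic -> root p y ->
  (forall i, (i < (size p).-1)%N ->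
     integralOver phi (t ^+ ((size p).-1 - i) * p`_i)) ->
  integralOver phi (t * y).
Proof.
move=> mp py hp; pose n := (size p).-1.
have sp : size p = n.+1 by rewrite /n polySpred // monic_neq0.
pose p' := \poly_(i < n.+1) (t ^+ (n - i) * p`_i).
have pn : p`_n = 1 by apply/monicP: mp; rewrite lead_coefE.
have mp' : p' \is monic.
  apply/monicP; rewrite lead_coef_poly ?subnn ?mul1r //.
  by rewrite pn oner_neq0.
apply: (integral_root_monic mp').
  apply/rootP; transitivity (t ^+ n * p.[y]); last by rewrite (rootP py) mulr0.
  rewrite horner_poly horner_coef sp mulr_sumr; apply: eq_bigr => i _.
  have -> : t ^+ n = t ^+ (n - i) * t ^+ i by rewrite -exprD subnK // -ltnS.
  by rewrite exprMn; ring.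
apply/integral_poly => i; rewrite coef_poly; case: ltnP => lei; last exact: integral0.
move: lei; rewrite ltnS leq_eqVlt => /predU1P[->|lti]; last exact: hp.
by rewrite subnn mul1r pn; exact: integral1.
Qed.

Lemma integral_lead_coef (q : {poly R}) x :
  phi (lead_coef q) != 0 -> root (map_poly phi q) x ->
  integralOver phi (phi (lead_coef q) * x).
Proof.
move=> d0 qx; set d := phi (lead_coef q).
have sq : size (map_poly phi q) = size q by rewrite size_poly_eq.
have ld : lead_coef (map_poly phi q) = d by rewrite lead_coefE sq coef_map.
apply: (@integral_scale _ _ (d^-1 *: map_poly phi q)).
- by apply/monicP; rewrite lead_coefZ ld mulVf.
- by rewrite rootZ // invr_neq0.
move=> i; rewrite size_scale ?invr_neq0 // sq => lti.
rewrite coefZ coef_map mulrA -(subnSK lti) exprSr mulfK // -rmorphXn -rmorphM.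
exact: integral_id.
Qed.

(** The integral equation of a / b, of degree n, is multiplied by b^n. *)
Lemma integral_quotient (a b : R) : phi b != 0 ->
  integralOver phi (phi a / phi b) ->
  exists n k, phi (a ^+ n) = phi (b * k).
Proof.
move=> b0 [P mP /rootP P0]; pose n := (size P).-1.
have sP : size P = n.+1 by rewrite /n polySpred // monic_neq0.
have sPE : size (map_poly phi P) = n.+1.
  rewrite -sP size_poly_eq // -lead_coefE (monicP mP) /=.
  by rewrite rmorph1 oner_neq0.
have Pn : P`_n = 1 by apply/monicP: mP; rewrite lead_coefE sP.
exists n, (- \sum_(i < n) P`_i * a ^+ i * b ^+ (n.-1 - i)).
move: P0; rewrite horner_coef sPE big_ord_recr /= coef_map /= Pn rmorph1 mul1r.
move=> /(congr1 (fun z => phi b ^+ n * z)); rewrite mulr0 mulrDr.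
rewrite expr_div_n mulrCA divff ?expf_neq0 // mulr1 => /eqP.
rewrite addrC addr_eq0 => /eqP; rewrite [phi (a ^+ n)]rmorphXn => ->.
rewrite mulrN rmorphN; congr (- _); rewrite mulr_sumr rmorphM rmorph_sum mulr_sumr.
apply: eq_bigr => -[i ltin] _ /=.
rewrite coef_map /= !rmorphM !rmorphXn expr_div_n.
have -> : phi b ^+ n = phi b ^+ i * phi b * phi b ^+ (n.-1 - i).
  by rewrite -exprSr -exprD; congr (_ ^+ _); lia.
by field; rewrite expf_neq0.
Qed.

(** The integral equation reads g Q(g) = - P_0. If P_0 is zero in [E], then Q(g) = 0 because g is
    not, and the induction goes on with [Q]. *)
Lemma integral_constant_term g : integralOver phi g -> g != 0 ->
  exists a w, [/\ phi a != 0, integralOver phi w & phi a = g * w].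
Proof.
move=> hg g0; have [P mP] := hg; move sP: (size P) => k.
elim: k P mP sP => [|k IH] P mP sP Pg.
  by move/eqP: sP; rewrite size_poly_eq0 (negPf (monic_neq0 mP)).
pose Q := drop_poly 1 P.
have PE : P = Q * 'X + (P`_0)%:P.
  rewrite -{1}(poly_take_drop 1 P) expr1 addrC; congr (_ + _).
  by apply/polyP => i; rewrite coef_take_poly coefC; case: i.
have Qg : (map_poly phi Q).[g] * g + phi P`_0 = 0.
  by move/rootP: Pg; rewrite {1}PE rmorphD rmorphM /= map_polyX map_polyC !hornerE.
have iQ : integralOver phi (map_poly phi Q).[g].
  by apply: integral_horner => //; apply/integral_poly => i; rewrite coef_map;
    exact: integral_id.
have [P0|P0] := eqVneq (phi P`_0) 0; last first.
  exists P`_0, (- (map_poly phi Q).[g]); split=> //; first exact: integral_opp.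
  by apply/eqP; rewrite mulrN mulrC -addr_eq0 addrC Qg.
have k0 : k != 0%N.
  apply/eqP => k0; move: P0; have /eqP/size_poly1P[c c0 PC] :
    size P = 1%N by rewrite sP k0.
  have : P`_0 = 1 by move/monicP: mP; rewrite lead_coefE sP k0.
  by move=> ->; rewrite rmorph1 => /eqP; rewrite oner_eq0.
apply: (IH Q).
- apply/monicP; move/monicP: mP; rewrite !lead_coefE size_drop_poly sP subn1 /=.
  by rewrite coef_drop_poly addn1 prednK ?lt0n.
- by rewrite size_drop_poly sP subn1.
- apply/rootP; move/eqP: Qg; rewrite P0 addr0 mulf_eq0 (negPf g0) orbF.
  by move/eqP.
Qed.

End Integrality.

(** The subring R[x] of [E] is represented by the evaluation map from [{poly R}]. *)
Definition adjoin (R E : comNzRingType) (phi : {rmorphism R -> E}) (x : E) :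
    {rmorphism {poly R} -> E} :=
  horner_morph (fun a => mulrC x (phi a)).

Lemma adjoinE (R E : comNzRingType) (phi : {rmorphism R -> E}) x p :
  adjoin phi x p = (map_poly phi p).[x].
Proof. by []. Qed.

Lemma adjoinC (R E : comNzRingType) (phi : {rmorphism R -> E}) x a :
  adjoin phi x a%:P = phi a.
Proof. exact: horner_morphC. Qed.

Lemma adjoinX (R E : comNzRingType) (phi : {rmorphism R -> E}) x :
  adjoin phi x 'X = x.
Proof. exact: horner_morphX. Qed.

(** * Zariski's lemma, adjoining one element at a time *)

Section Goldman.
Variable E : fieldType.

(** [E] is integral over the subring generated by the image of [R] and [l]. The source ring becomes
    [{poly R}] at each step, hence the quantifier over [R] inside the recursion. *)
Fixpoint integral_over_adjoin (l : seq E) :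
    forall R : comNzRingType, {rmorphism R -> E} -> Prop :=
  if l is x :: l' then fun R phi => integral_over_adjoin l' (adjoin phi x)
  else fun R phi => integralRange phi.

Lemma adjoin_integral (R : comNzRingType) (phi : {rmorphism R -> E}) x d w :
  integralOver phi (phi d * x) ->
  exists M, forall k, (M <= k)%N -> integralOver phi (phi d ^+ k * adjoin phi x w).
Proof.
move=> hx; have hd := integral_id phi d.
elim/poly_ind: w => [|w c [M IH]].
  by exists 0%N => k _; rewrite rmorph0 mulr0; exact: integral0.
exists M.+1 => -[|k] // leM.
rewrite adjoinE rmorphD rmorphM /= map_polyX map_polyC !hornerE -adjoinE.
rewrite mulrDr exprSr mulrACA; apply: integral_add.
  by apply: integral_mul hx; exact: IH.
by rewrite -exprSr; apply: integral_mul (integral_exp _ hd) (integral_id _ _).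
Qed.

(* If [x] were transcendental, [1 + x f] would divide a power of [f] in a
   polynomial ring. *)
Lemma adjoin_transcendental (R : comNzRingType) (phi : {rmorphism R -> E}) x f :
  (forall q, root (map_poly phi q) x -> map_poly phi q = 0) ->
  adjoin phi x f != 0 ->
  (forall e, exists N, integralOver (adjoin phi x) (adjoin phi x f ^+ N * e)) ->
  False.
Proof.
move=> trx f0 hf; pose F := map_poly phi f.
have F0 : F != 0 by apply: contraNneq f0 => F0; rewrite adjoinE -/F F0 horner0.
pose g := 1 + 'X * f; pose G := map_poly phi g.
have GE : G = 1 + 'X * F by rewrite /G rmorphD rmorphM /= rmorph1 map_polyX.
have g0 : adjoin phi x g != 0.
  apply/eqP => /rootP/trx; rewrite -/G GE => /(congr1 (fun p : {poly E} => p`_0)).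
  by rewrite coefD coef1 coefXM addr0 coef0 => /eqP; rewrite oner_eq0.
have [N hN] := hf (adjoin phi x g)^-1.
rewrite -rmorphXn in hN.
have [n [k]] := integral_quotient g0 hN.
move=> /eqP; rewrite -subr_eq0 -rmorphB adjoinE => /trx/eqP.
rewrite rmorphB subr_eq0 !rmorphM /= !rmorphXn /= -/F -/G => /eqP FG.
have cGF : coprimep G F.
  by apply/Bezout_eq1_coprimepP; exists (1, - 'X); rewrite /= GE; ring.
have {cGF}: coprimep G ((F ^+ N) ^+ n) by do 2!apply: coprimep_expr.
rewrite FG => /(coprimep_dvdl (dvdp_mulIl _ _)).
rewrite coprimepp GE addrC size_polyDl mulrC size_mulX // ?size_poly1 ?ltnS.
  by rewrite eqSS size_poly_eq0 (negPf F0).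
by rewrite size_poly_gt0.
Qed.

(** If d is the leading coefficient of an equation of x, then d x is integral, and so is d^M f(x),
    which therefore divides a nonzero constant a. Powers of d a then do the work of powers of
    f(x). *)
Lemma adjoin_algebraic (R : comNzRingType) (phi : {rmorphism R -> E}) x q f :
  root (map_poly phi q) x -> map_poly phi q != 0 ->
  adjoin phi x f != 0 ->
  (forall e, exists N, integralOver (adjoin phi x) (adjoin phi x f ^+ N * e)) ->
  exists2 b, phi b != 0 & forall e, exists N, integralOver phi (phi b ^+ N * e).
Proof.
move=> + /trim_poly[q' q'E d0]; rewrite -q'E => /(integral_lead_coef d0).
move: {q q' q'E}(lead_coef q') d0 => d d0 hdx f0 hf.
have hd := integral_id phi d.
have [M hM] := adjoin_integral f hdx.
have dM0 : phi d ^+ M * adjoin phi x f != 0 by rewrite mulf_neq0 ?expf_neq0.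
have [a [w [a0 hw aE]]] := integral_constant_term (hM _ (leqnn M)) dM0.
exists (d * a) => [|e]; first by rewrite rmorphM mulf_neq0.
have [N [P mP Py]] := hf e; set y := _ * e in Py.
have /choice[K hK] : forall i, exists K, forall k, (K <= k)%N ->
    integralOver phi (phi d ^+ k * adjoin phi x P`_i).
  by move=> i; exact: adjoin_integral.
pose L := (\max_(i < size P) K i)%N.
have hy : integralOver phi (phi d ^+ L * y).
  apply: (@integral_scale _ _ _ _ _ (map_poly (adjoin phi x) P)) => //.
    exact: monic_map.
  rewrite size_map_poly_id0 ?(monicP mP) ?rmorph1 ?oner_neq0 // => i lti.
  have ltiP : (i < size P)%N := leq_trans lti (leq_pred _).
  rewrite coef_map -exprM; apply: hK; apply: (@leq_trans L).
    exact: (leq_bigmax (Ordinal ltiP)).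
  by rewrite leq_pmulr // subn_gt0.
(* d^L makes y = f(x)^N e integral over [R], and a^N, equal to (d^M f(x) w)^N, supplies the factor
   f(x)^N. *)
exists (L + N)%N; rewrite rmorphM.
have -> : (phi d * phi a) ^+ (L + N) * e =
    phi d ^+ N * (phi a ^+ L * ((phi d ^+ L * y) * (phi d ^+ M * w) ^+ N)).
  rewrite /y exprMn exprD [phi a ^+ (L + N)]exprD [in phi a ^+ N]aE.
  by rewrite !exprMn; ring.
apply: integral_mul (integral_exp _ hd) _.
apply: integral_mul (integral_exp _ (integral_id _ _)) _.
by apply: integral_mul hy _; apply: integral_exp; apply: integral_mul hw;
  exact: integral_exp.
Qed.

(** A single denominator b suffices: the field [E] is integral over R[1/b]. *)
Lemma integral_over_adjoin_denominator (l : seq E) (R : comNzRingType)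
    (phi : {rmorphism R -> E}) :
  integral_over_adjoin l phi ->
  exists2 b, phi b != 0 & forall e, exists N, integralOver phi (phi b ^+ N * e).
Proof.
elim: l R phi => [|x l IH] R phi /= h.
  exists 1 => [|e]; first by rewrite rmorph1 oner_neq0.
  by exists 0%N; rewrite mul1r.
have [f f0 hf] := IH _ _ h.
have [[q [qx q0]]|trx] :=
    pselect (exists q, root (map_poly phi q) x /\ map_poly phi q != 0).
  exact: adjoin_algebraic qx q0 f0 hf.
exfalso; apply: (adjoin_transcendental (x := x) (f := f) (phi := phi)) => // q qx.
by apply: contrapT => /eqP q0; apply: trx; exists q.
Qed.

(** The equation comes from substituting b^N X into the monic one of b^N e. That its leading
    coefficient survives in [E] is what later makes the polynomials f_i regular. *)
Lemma algebraic_over_adjoin (l : seq E) (R : comNzRingType)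
    (phi : {rmorphism R -> E}) (e : E) :
  integral_over_adjoin l phi ->
  exists2 q, phi (lead_coef q) != 0 & root (map_poly phi q) e.
Proof.
move=> /integral_over_adjoin_denominator[b b0 /(_ e)[N [P mP Pe]]].
have bN0 : phi b ^+ N != 0 by rewrite expf_neq0.
have mQ : map_poly phi (P \Po (b ^+ N *: 'X)) = map_poly phi P \Po (phi b ^+ N *: 'X).
  by rewrite map_comp_poly linearZ /= map_polyX rmorphXn.
have Q0 : map_poly phi (P \Po (b ^+ N *: 'X)) != 0.
  rewrite mQ comp_poly_eq0 ?size_scale ?size_polyX //.
  by rewrite monic_neq0 // monic_map.
have [q qE q0] := trim_poly Q0; exists q => //.
by rewrite qE mQ rootE horner_comp hornerZ hornerX; exact: Pe.
Qed.

End Goldman.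

(** Regularity after inverting [S], with no condition of properness. This form passes to polynomial
    rings and descends along a retraction; properness is seen in the local ring. *)
Definition weakly_regular (B : comNzRingType) (S : B -> Prop) (s : seq B) : Prop :=
  forall i, (i < size s)%N -> forall x, gen_ideal (take i s) (s`_i * x) ->
    exists2 c, S c & gen_ideal (take i s) (c * x).

(** * Regular sequences and finite generation via retracts *)

Section WeakRegularity.
Variable B : comNzRingType.

Lemma gen_ideal_polyC (s : seq B) (x : {poly B}) :
  gen_ideal (map polyC s) x <-> forall k, gen_ideal s x`_k.
Proof.
have hs := gen_ideal_ideal s; split=> [|hx].
  apply: (@gen_ideal_min {poly B} _ (fun p => forall k, gen_ideal s p`_k)).
    split=> [k|p q hp hq k|a p hp k].
    - by rewrite coef0; exact: ideal_0.
    - by rewrite coefD; exact: ideal_D.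
    - by rewrite coefM; apply: ideal_sum => // i _; exact: ideal_M.
  move=> _ /mapP[a sa ->] k; rewrite coefC; case: eqP => _.
    exact: gen_ideal_mem.
  exact: ideal_0.
rewrite -[x]coefK poly_def; have hP := gen_ideal_ideal (map polyC s).
apply: ideal_sum => // i _; rewrite -mul_polyC mulrC; apply: ideal_M => //.
exact: gen_ideal_map.
Qed.

Variable S : B -> Prop.
Hypotheses (S1 : S 1) (SM : forall x y, S x -> S y -> S (x * y)).

Lemma common_multiplier (s : seq B) (x : {poly B}) :
  (forall k, exists2 c, S c & gen_ideal s (c * x`_k)) ->
  exists2 c, S c & forall k, gen_ideal s (c * x`_k).
Proof.
move=> hx; have hs := gen_ideal_ideal s.
have /choice[c hc] : forall k, exists c, S c /\ gen_ideal s (c * x`_k).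
  by move=> k; have [c] := hx k; exists c.
exists (\prod_(k < size x) c k).
  by apply: (big_ind S) => // k _; have [] := hc k.
move=> k; have [ltk|lek] := ltnP k (size x).
  rewrite (bigD1 (Ordinal ltk)) //= mulrAC mulrC.
  by apply: ideal_M => //; have [] := hc k.
by rewrite nth_default // mulr0; exact: ideal_0.
Qed.

(** [f] is a nonzerodivisor modulo the [S]-saturation [J] of (s): the top coefficient of f x, a
    multiple of that of x by an element of [S], puts the latter into [J], and the top term can be
    subtracted. *)
Lemma saturated_divide (s : seq B) (f x : {poly B}) : S (lead_coef f) ->
  (forall k, exists2 c, S c & gen_ideal s (c * (f * x)`_k)) ->
  forall k, exists2 c, S c & gen_ideal s (c * x`_k).
Proof.
pose J y := exists2 c, S c & gen_ideal s (c * y).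
have hs := gen_ideal_ideal s; have hJ : is_ideal J.
  split=> [|y z [c Sc hc] [d Sd hd]|a y [c Sc hc]].
  - by exists 1; rewrite ?mulr0 //; exact: ideal_0.
  - exists (c * d); first exact: SM.
    have -> : c * d * (y + z) = d * (c * y) + c * (d * z) by ring.
    by apply: ideal_D => //; exact: ideal_M.
  - by exists c; rewrite // mulrCA; exact: ideal_M.
move=> Sf; suff claim n (g : {poly B}) : (size g <= n)%N ->
    (forall k, J (f * g)`_k) -> forall k, J g`_k by exact: claim (leqnn _).
elim: n g => {x}[|n IH] x.
  rewrite leqn0 size_poly_eq0 => /eqP-> _ k.
  by rewrite coef0; exact: ideal_0.
move=> lex hfx k; have Jn : J x`_n.
  have [sx|ltx] := eqVneq (size x) n.+1; last first.
    rewrite nth_default; first exact: ideal_0.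
    by rewrite -ltnS ltn_neqAle ltx.
  have [c Sc hc] := hfx (size f + size x).-2.
  exists (c * lead_coef f); first exact: SM.
  by move: hc; rewrite -mul_lead_coef -mulrA [lead_coef x]lead_coefE sx.
have xE : x = take_poly n x + x`_n *: 'X^n.
  apply/polyP => i; rewrite coefD coef_take_poly coefZ coefXn.
  have [lti|lti|->] := ltngtP i n; rewrite ?mulr0 ?addr0 ?mulr1 ?add0r //.
  by rewrite nth_default // (leq_trans lex).
have {}IH : forall k, J (take_poly n x)`_k.
  apply: IH => [|i]; first exact: size_take_poly.
  have -> : take_poly n x = x - x`_n *: 'X^n by rewrite {2}xE addrK.
  rewrite mulrBr coefB; apply: ideal_B (hfx i) _ => //.
  by rewrite -scalerAr coefZ mulrC; exact: ideal_M.
rewrite xE coefD; apply: ideal_D (IH k) _ => //.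
by rewrite coefZ mulrC; exact: ideal_M.
Qed.

(** The old elements are treated coefficientwise, the new one by its leading coefficient. The
    multipliers remain constants, so the lemma can be iterated. *)
Lemma weakly_regular_poly (s : seq B) (f : {poly B}) :
  weakly_regular S s -> S (lead_coef f) ->
  let S' := fun c => exists2 a, S a & c = a%:P in
  weakly_regular S' (rcons (map polyC s) f) .
Proof.
move=> wreg Sf S' i; rewrite size_rcons size_map ltnS => lei x.
have -> : take i (rcons (map polyC s) f) = map polyC (take i s).
  by rewrite -cats1 takel_cat ?size_map // map_take.
move=> /gen_ideal_polyC hx.
suff [c Sc hc] : exists2 c, S c & forall k, gen_ideal (take i s) (c * x`_k).
  by exists c%:P; [exists c | apply/gen_ideal_polyC => k; rewrite coefCM].
apply: common_multiplier; move: lei hx; rewrite leq_eqVlt => /predU1P[->|lti].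
  rewrite nth_rcons size_map ltnn eqxx => hx; apply: saturated_divide Sf _ => k.
  by exists 1 => //; rewrite mul1r.
rewrite nth_rcons size_map lti (nth_map 0) // => hx k.
by apply: wreg => //; rewrite -coefCM.
Qed.

End WeakRegularity.

(** * Noetherian rings and residue fields *)

Section Noetherian.

Definition noetherian_pred (B : comNzRingType) : Prop :=
  forall I : B -> Prop, is_ideal I ->
    exists2 s, {in s, forall x, I x} & forall x, I x -> gen_ideal s x.

Lemma noetherian_uniformizer (O : idomainType) (pi : O) :
  is_uniformizer pi -> noetherian_pred O.
Proof.
move=> [pi0 piU dvr] I hI.
have [[a Ia a0]|I0] := pselect (exists2 a, I a & a != 0); last first.
  exists [::] => // x Ix; apply/gen_ideal_nil; apply: contrapT => /eqP x0.
  by apply: I0; exists x.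
have Ipi u k : u \is a GRing.unit -> I (u * pi ^+ k) -> I (pi ^+ k).
  by move=> uU /(ideal_M hI u^-1); rewrite mulKr.
have ex_k : exists k, `[< I (pi ^+ k) >].
  by have [u [k [uU aE]]] := dvr _ a0; exists k; apply/asboolP/(Ipi u); rewrite -?aE.
case: (ex_minnP ex_k) => k /asboolP Ik mink; exists [:: pi ^+ k].
  by move=> x; rewrite inE => /eqP->.
move=> x Ix; have hg := gen_ideal_ideal [:: pi ^+ k].
have [->|x0] := eqVneq x 0; first exact: ideal_0.
have [u [l [uU xE]]] := dvr _ x0.
have lekl : (k <= l)%N by apply: mink; apply/asboolP/(Ipi u); rewrite -?xE.
rewrite xE -(subnK lekl) exprD mulrA; apply: ideal_M => //.
by apply: gen_ideal_mem; rewrite inE.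
Qed.

Variable B : comNzRingType.
Hypothesis noethB : noetherian_pred B.

(** [L d] collects the coefficients at degree [d] of the members of degree at most [d]. These ideals
    grow with [d] and are constant from [D] on, so generators for the degrees up to [D] suffice. *)
Lemma hilbert_basis : noetherian_pred {poly B}.
Proof.
move=> I hI.
pose L d a := exists2 p, I p & (size p <= d.+1)%N /\ p`_d = a.
have hL d : is_ideal (L d).
  split.
  - by exists 0; [exact: ideal_0 | rewrite size_poly0 coef0].
  - move=> _ _ [p Ip [sp <-]] [q Iq [sq <-]]; exists (p + q).
      exact: ideal_D.
    by rewrite coefD (leq_trans (size_polyD _ _)) // geq_max sp.
  - move=> a _ [p Ip [sp <-]]; exists (a%:P * p); first exact: ideal_M.
    by rewrite coefCM mul_polyC (leq_trans (size_scale_leq _ _)).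
have L_up d e a : (d <= e)%N -> L d a -> L e a.
  move=> led [p Ip [sp pd]]; exists (p * 'X^(e - d)).
    by rewrite mulrC; exact: ideal_M.
  rewrite coefMXn ltnNge leq_subr /= subKn // pd; split=> //.
  apply: leq_trans (size_polyMleq _ _) _; rewrite size_polyXn addnS /=.
  by rewrite -(subnK led) addnK addnC -addnS leq_add2l.
pose Lu a := exists d, L d a.
have hLu : is_ideal Lu.
  split.
  - by exists 0%N; exact: ideal_0 (hL _).
  - move=> x y [d hx] [e hy]; exists (maxn d e); apply: ideal_D => //.
      by apply: L_up hx; exact: leq_maxl.
    by apply: L_up hy; exact: leq_maxr.
  - by move=> a x [d hx]; exists d; exact: ideal_M.
have [t Lt tgen] := noethB hLu.
have [D hD] : exists D, {in t, forall a, L D a}.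
  elim: t Lt {tgen} => [|a t IH] Lt; first by exists 0%N.
  have [D hD] := IH (fun b bt => Lt b (mem_behead (s := a :: t) bt)).
  have [d hd] := Lt a (mem_head _ _); exists (maxn d D) => b.
  rewrite inE => /predU1P[->|/hD]; first by apply: L_up hd; exact: leq_maxl.
  by apply: L_up; exact: leq_maxr.
have LD e a : L e a -> L D a.
  by move=> ha; apply: (gen_ideal_min (hL D) hD); apply: tgen; exists e.
have /choice[g hg] : forall d, exists s : seq {poly B}, {in s, forall p, I p} /\
    forall a, L d a -> exists2 q, gen_ideal s q & (size q <= d.+1)%N /\ q`_d = a.
  move=> d; have [u Lu' ugen] := noethB (hL d).
  have /choice[h hh] : forall a, exists p, L d a ->
      [/\ I p, (size p <= d.+1)%N & p`_d = a].
    move=> a; have [[p Ip [sp pa]]|nL] := pselect (L d a); first by exists p.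
    by exists 0.
  exists (map h u); split=> [_ /mapP[a ua ->]|a /ugen[c ->]].
    by have [] := hh a (Lu' _ ua).
  exists (\sum_(i < size u) (c i)%:P * h u`_i).
    apply: ideal_sum => [|i _]; first exact: gen_ideal_ideal.
    apply: (ideal_M (gen_ideal_ideal _)); apply: gen_ideal_mem.
    by rewrite map_f // mem_nth.
  have hu (i : 'I_(size u)) := hh _ (Lu' _ (mem_nth 0 (ltn_ord i))).
  split; last first.
    by rewrite coef_sum; apply: eq_bigr => i _; rewrite coefCM; have [_ _ ->] := hu i.
  apply: leq_trans (size_sum _ _ _) _; apply/bigmax_leqP => i _.
  rewrite mul_polyC (leq_trans (size_scale_leq _ _)) //.
  by have [] := hu i.
exists (flatten [seq g d | d <- iota 0 D.+1]).
  move=> p /flattenP[_ /mapP[d _ ->]]; by have [h _] := hg d; exact: h.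
set s := flatten _; have hs := gen_ideal_ideal s.
have sub d : (d <= D)%N -> {subset g d <= s}.
  move=> led p pg; apply/flattenP; exists (g d) => //.
  by apply: map_f; rewrite mem_iota.
move=> p; move: {2}(size p) (leqnn (size p)) => n.
elim: n p => [|n IH] p.
  by rewrite leqn0 size_poly_eq0 => /eqP-> _; exact: ideal_0.
move=> sp Ip; have Ln : L n p`_n by exists p.
(* Beyond degree [D], an element of degree at most [D] times a power of the variable cancels the top
   term. *)
pose d := minn n D; have led : (d <= n)%N by exact: geq_minl.
have Ld : L d p`_n.
  by rewrite /d; case: (leqP n D) => _ //; exact: LD Ln.
have [_ /(_ _ Ld)[q gq [sq qd]]] := hg d.
have {}gq : gen_ideal s q.
  by apply: gen_ideal_sub gq; apply: sub; exact: geq_minr.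
have Iq : I q.
  apply: (gen_ideal_min hI) gq => r /flattenP[_ /mapP[e _ ->]].
  by have [h _] := hg e; exact: h.
rewrite -(subrK (q * 'X^(n - d)) p).
have gX : gen_ideal s (q * 'X^(n - d)) by rewrite mulrC; exact: ideal_M.
apply: ideal_D => //; apply: IH; last first.
  by apply: ideal_B => //; rewrite mulrC; exact: ideal_M.
have sX : (size (q * 'X^(n - d))%R <= n.+1)%N.
  apply: leq_trans (size_polyMleq _ _) _; rewrite size_polyXn addnS /=.
  by rewrite -[X in (_ <= X.+1)%N](subnKC led) -addSn leq_add2r.
apply/leq_sizeP => j lenj; rewrite coefB.
move: lenj; rewrite leq_eqVlt => /predU1P[<-|ltnj].
  by rewrite coefMXn ltnNge leq_subr /= subKn // qd subrr.
by rewrite !nth_default ?subr0 // (leq_trans _ ltnj).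
Qed.

End Noetherian.

Section ResidueField.
Variables (A : comNzRingType) (m : idealr A).
Local Notation Q := {ideal_quot m}.

Lemma exists_residue_field :
  (forall a, a \notin m -> exists b, a * b - 1 \in m) ->
  exists (E : fieldType) (phi : {rmorphism A -> E}),
    (forall a, (phi a == 0) = (a \in m)) /\ (forall e, exists a, phi a = e).
Proof.
move=> m_inv.
have piE (a b : A) : (\pi_Q a == \pi_Q b) = (a - b \in m).
  by rewrite -Quotient.idealrBE.
have pi_surj (x : Q) : exists a, \pi_Q a = x by elim/quotW: x => a; exists a.
have /choice[inv hinv] : forall x : Q, exists y : Q,
    (x != 0 -> (y : Q) * x = 1) /\ (x = 0 -> y = 0).
  move=> x; have [->|x0] := eqVneq x 0; first by exists 0; split.
  have [a aE] := pi_surj x.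
  have am : a \notin m.
    by apply: contra x0; rewrite -aE -[0](rmorph0 \pi_Q) piE subr0.
  have [b hb] := m_inv _ am; exists (\pi_Q b); split=> [_|x0'];
    last by rewrite x0' eqxx in x0.
  by apply/eqP; rewrite -aE -(rmorph1 \pi_Q) -[\pi_Q b * _](rmorphM \pi_Q) piE mulrC.
have mulV (x : Q) : x != 0 -> (inv x : Q) * x = 1 by have [h _] := hinv x.
have inv0 : inv 0 = 0 :> Q by have [_ ->] := hinv 0.
pose fm := GRing.ComNzRing_isField.Build Q mulV inv0.
pose E : fieldType := HB.pack Q fm.
exists E, (\pi_Q : {rmorphism A -> E}); split=> [a|e]; last exact: pi_surj.
by have := piE a 0; rewrite subr0 (rmorph0 \pi_Q).
Qed.

End ResidueField.

(** If [a] had no inverse modulo [m], then m + (a) would be a proper ideal, hence contained in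
    [m]. *)
Lemma maximal_ideal_inverse (A : comNzRingType) (m : prime_idealr A) (a : A) :
  maximal_ideal m -> a \notin m -> exists b, a * b - 1 \in m.
Proof.
move=> mmax am; apply: contrapT => noinv.
pose I : {pred A} := fun x => `[< exists b, x - a * b \in m >].
have I_ideal : idealr_closed I.
  split.
  - by apply/asboolP; exists 0; rewrite mulr0 subr0 rpred0.
  - by apply/asboolPn => -[b hb]; apply: noinv; exists b; rewrite -opprB rpredN.
  - move=> c x y /asboolP[b hb] /asboolP[d hd]; apply/asboolP.
    exists (c * b + d); rewrite mulrDr opprD addrACA mulrCA -mulrBr.
    by rewrite rpredD // idealMr.
pose mI := isIdealr.Build A I I_ideal.
pose J : idealr A := HB.pack I mI.
have mJ : {subset m <= J}.
  by move=> x xm; apply/asboolP; exists 0; rewrite mulr0 subr0.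
move: am; rewrite (mmax J mJ) //; apply/asboolP; exists 1.
by rewrite mulr1 subrr rpred0.
Qed.

(** * Descent along a linear retraction *)

Section Retract.
Variables (A R : comNzRingType) (iota : {rmorphism A -> R}) (rho : {additive R -> A}).
Hypothesis rhoM : forall a r, rho (iota a * r) = a * rho r.
Hypothesis rho1 : rho 1 = 1.

Lemma retractK : cancel iota rho.
Proof. by move=> a; rewrite -[iota a]mulr1 rhoM rho1 mulr1. Qed.

Lemma retract_gen_ideal (s : seq A) (a : A) :
  gen_ideal (map iota s) (iota a) -> gen_ideal s a.
Proof.
move=> [r aE]; exists (rho \o r).
rewrite -(retractK a) aE raddf_sum size_map; apply: eq_bigr => i _ /=.
by rewrite (nth_map 0) // mulrC rhoM mulrC.
Qed.

(** The extension [J] of [I] has finitely many generators, which involve finitely many elements of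
    [I]. Applying [rho] to relations shows that these generate [I]. *)
Lemma retract_noetherian : noetherian_pred R -> noetherian A.
Proof.
move=> noethR I.
pose J r := exists2 s, {subset s <= I} & gen_ideal (map iota s) r.
have J_mem a : a \in I -> J (iota a).
  move=> aI; exists [:: a]; first by move=> b; rewrite inE => /eqP->.
  by apply: gen_ideal_mem; rewrite inE.
have hJ : is_ideal J.
  split=> [|x y [s sI hx] [t tI hy]|b x [s sI hx]].
  - by exists [::] => //; exact: ideal_0 (gen_ideal_ideal _).
  - exists (s ++ t); first by move=> z; rewrite mem_cat => /orP[/sI|/tI].
    rewrite map_cat; apply: ideal_D; first exact: gen_ideal_ideal.
      by apply: gen_ideal_sub hx => z zs; rewrite mem_cat zs.
    by apply: gen_ideal_sub hy => z zs; rewrite mem_cat zs orbT.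
  - by exists s => //; apply: ideal_M hx; exact: gen_ideal_ideal.
have [t tJ tgen] := noethR J hJ.
have [s sI hs] : exists2 s, {subset s <= I} &
  {in t, forall r, gen_ideal (map iota s) r}.
  elim: t tJ {tgen} => [|r t IH] tJ; first by exists [::].
  have [s sI hs] := IH (fun x xt => tJ x (mem_behead (s := r :: t) xt)).
  have [u uI hu] := tJ r (mem_head _ _).
  exists (u ++ s); first by move=> z; rewrite mem_cat => /orP[/uI|/sI].
  move=> x; rewrite map_cat inE => /predU1P[->|/hs hx].
    by apply: gen_ideal_sub hu => z zs; rewrite mem_cat zs.
  by apply: gen_ideal_sub hx => z zs; rewrite mem_cat zs orbT.
exists s => x; split=> [xI|]; last first.
  by apply: gen_ideal_min (idealr_is_ideal I) _; exact: sI.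
apply: retract_gen_ideal; apply: gen_ideal_min hs _; first exact: gen_ideal_ideal.
exact/tgen/J_mem.
Qed.

End Retract.

(* [rho] carries the relations found in the overring [R] back to [A]. *)
Lemma regular_sequence_loc (A : idomainType) (R : comNzRingType)
    (iota : {rmorphism A -> R}) (rho : {additive R -> A})
    (S : R -> Prop) (m : prime_idealr A) (s : seq A) :
  (forall a r, rho (iota a * r) = a * rho r) -> rho 1 = 1 ->
  {subset s <= m} ->
  (forall c, S c -> exists2 b, b \notin m & c = iota b) ->
  weakly_regular S (map iota s) ->
  regular_sequence (map (@loc A m) s).
Proof.
move=> rhoM rho1 sm hS wreg; split=> [i|]; last first.
  move=> /(gen_ideal_min (idealr_is_ideal (localization_ideal m))) h.
  have : (1 : localization m) \in localization_ideal m.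
    by apply: h => _ /mapP[a /sm am ->]; rewrite loc_in_ideal.
  by rewrite idealr1.
rewrite size_map => lti x; rewrite -map_take (nth_map 0) //.
have [a [t [tm xE]]] := locP x; move=> hx.
have ut := loc_unit tm; have hg := gen_ideal_ideal (map (@loc A m) (take i s)).
have {hx} : gen_ideal (map (@loc A m) (take i s)) (loc m (s`_i * a)).
  by rewrite rmorphM /= -xE mulrCA; exact: ideal_M.
move=> /gen_ideal_loc[u um hu].
have {hu} : gen_ideal (take i (map iota s)) ((map iota s)`_i * iota (u * a)).
  rewrite -map_take (nth_map 0) // -rmorphM mulrCA; exact: gen_ideal_map.
move=> /(wreg _ _ _)[|c /hS[b bm ->]]; first by rewrite size_map.
rewrite -rmorphM -map_take => /(retract_gen_ideal rhoM rho1).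
rewrite mulrA => hba; rewrite -(mulKr ut x) xE; apply: ideal_M => //.
by apply/gen_ideal_loc; exists (b * u) => //; exact: notin_primeM.
Qed.

(** Contraction keeps the inclusions strict because every element of the localization is a unit
    times some [loc m a]. *)
Lemma prime_chain_loc (A : idomainType) (m : prime_idealr A) (n : nat) :
  prime_chain (localization m) n -> exists p : nat -> A -> Prop,
  [/\ forall i, is_prime (p i),
      forall i, (i < n)%N -> forall x, p i x -> p i.+1 x,
      forall i, (i < n)%N -> exists2 x, p i.+1 x & ~ p i x &
      forall i x, p i x -> x \in m].
Proof.
move=> [q hq]; exists (fun i x => loc m x \in q i); split.
- move=> i; have [_ h1 hM] := prime_idealr_is_prime (q i); split; first split.
  + by rewrite rmorph0; exact: rpred0.
  + by move=> x y; rewrite rmorphD; exact: rpredD.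
  + by move=> a x; rewrite rmorphM; exact: idealMr.
  + by rewrite rmorph1.
  + by move=> x y; rewrite rmorphM; exact: hM.
- by move=> i /hq[sub _] x; exact: sub.
- move=> i /hq[_ nsub]; apply: contrapT => nox; apply: nsub => x xq.
  have [a [s [sm xE]]] := locP x; apply: contrapT => xn; apply: nox; exists a.
    by rewrite -xE; apply: idealMr.
  rewrite -xE => h; apply: xn; rewrite -(mulKr (loc_unit sm) x).
  exact: idealMr.
- move=> i x xq; apply: contrapT => /negP/loc_unit u.
  exact: (prime_unit (prime_idealr_is_prime (q i)) u xq).
Qed.

(** The variables are adjoined one by one, each with its polynomial; substituting X^N leaves the
    leading coefficient unchanged. *)
Lemma polynomial_weakly_regular (O : idomainType) (S : O -> Prop) (s : seq O)
    (N : nat) (q1 q2 q3 : {poly O}) :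
  S 1 -> (forall x y, S x -> S y -> S (x * y)) -> (0 < N)%N ->
  weakly_regular S s ->
  S (lead_coef q1) -> S (lead_coef q2) -> S (lead_coef q3) ->
  let C1 := @polyC O in
  let C2 := @polyC {poly O} in
  let C3 := @polyC {poly {poly O}} in
  weakly_regular (fun c => exists2 a, S a & c = C3 (C2 (C1 a)))
    (map (C3 \o C2 \o C1) s ++
     [:: C3 (C2 (q1 \Po 'X^N)); C3 (map_poly C1 q2 \Po 'X^N);
         map_poly (C2 \o C1) q3 \Po 'X^N]).
Proof.
move=> S1 SM N0 wreg l1 l2 l3 C1 C2 C3.
have leadX (B : idomainType) (q : {poly B}) :
    lead_coef (q \Po 'X^N) = lead_coef q.
  by rewrite lead_coef_comp ?size_polyXn // lead_coefXn expr1n mulr1.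
pose S' (c : {poly O}) := exists2 a, S a & c = C1 a.
pose S'' (c : {poly {poly O}}) := exists2 a, S' a & c = C2 a.
have S'1 : S' 1 by exists 1.
have S''1 : S'' 1 by exists 1.
have S'M x y : S' x -> S' y -> S' (x * y).
  by move=> [a Sa ->] [b Sb ->]; exists (a * b); [exact: SM | rewrite /C1 polyCM].
have S''M x y : S'' x -> S'' y -> S'' (x * y).
  by move=> [a Sa ->] [b Sb ->]; exists (a * b); [exact: S'M | rewrite /C2 polyCM].
have l1' : S (lead_coef (q1 \Po 'X^N)) by rewrite leadX.
have l2' : S' (lead_coef (map_poly C1 q2 \Po 'X^N)).
  rewrite leadX (lead_coef_map_inj (@polyC_inj O)) ?rmorph0 //.
  by exists (lead_coef q2).
have l3' : S'' (lead_coef (map_poly (C2 \o C1) q3 \Po 'X^N)).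
  have C_inj : injective (C2 \o C1) by move=> x y /polyC_inj/polyC_inj.
  have C0 : (C2 \o C1) 0 = 0 by rewrite /= /C1 /C2 !polyC0.
  rewrite leadX (lead_coef_map_inj C_inj C0).
  by exists (C1 (lead_coef q3)) => //; exists (lead_coef q3).
have w1 := weakly_regular_poly S1 SM wreg l1'.
have w2 := weakly_regular_poly S'1 S'M w1 l2'.
have w3 := weakly_regular_poly S''1 S''M w2 l3'.
move: w3; rewrite !map_rcons -!map_comp -!cats1 -!catA /= => w3 i lti x hx.
have [c [_ [_ [a Sa ->] ->] ->] hc] := w3 i lti x hx.
by exists (C3 (C2 (C1 a))) => //; exists a.
Qed.

Lemma weakly_regular_uniformizer (O : idomainType) (S : O -> Prop)
    (pi : O) (b : bool) :
  S 1 -> pi != 0 -> weakly_regular S (if b then [:: pi] else [::]).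
Proof.
move=> S1 pi0; case: b => // -[|//] _ x /gen_ideal_nil /eqP.
rewrite mulf_eq0 (negPf pi0) => /eqP->; exists 1 => //.
by apply/gen_ideal_nil; rewrite mulr0.
Qed.

(* [mpoly] serves to bound the dimension, the iterated [poly] to prove
   regularity and finite generation. *)
Theorem cohen_macaulay_retract (O A : idomainType) (pi : O) (N : nat)
    (c : {rmorphism O -> A}) (iota0 : {rmorphism A -> {mpoly O[3]}})
    (iota : {rmorphism A -> {poly {poly {poly O}}}})
    (rho : {additive {poly {poly {poly O}}} -> A}) (y1 y2 y3 : A) :
  is_uniformizer pi -> (0 < N)%N ->
  injective iota0 -> (forall a, iota0 (c a) = a%:MP) ->
  (forall a r, rho (iota a * r) = a * rho r) -> rho 1 = 1 ->
  (forall a, iota (c a) = a%:P%:P%:P) ->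
  iota y1 = ('X^N)%:P%:P -> iota y2 = ('X^N)%:P -> iota y3 = 'X^N ->
  (forall (E : fieldType) (phi : {rmorphism A -> E}),
    (forall e, exists a, phi a = e) ->
     integral_over_adjoin [:: phi y1; phi y2; phi y3] (phi \o c)) ->
  cohen_macaulay A.
Proof.
move=> hpi N0 inj0 iota0c rhoM rho1 iotac y1E y2E y3E hint; split.
  apply: (retract_noetherian rhoM rho1).
  by do 3!apply: hilbert_basis; exact: noetherian_uniformizer hpi.
move=> m mmax.
have [E [phi [phi0 phi_surj]]] :=
  exists_residue_field (fun a => maximal_ideal_inverse (a := a) mmax).
pose S a : Prop := c a \notin m.
have root_of e : exists2 q : {poly O}, S (lead_coef q) & (map_poly c q).[e] \in m.
  have [q l0 qe] := algebraic_over_adjoin (phi e) (hint E phi phi_surj); exists q.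
    by rewrite /S -phi0.
  by rewrite -phi0 -horner_map -map_poly_comp.
have [q1 l1 m1] := root_of y1; have [q2 l2 m2] := root_of y2.
have [q3 l3 m3] := root_of y3.
(* The sequence has length 4 or 3 according to whether [pi] lies in [m], matching the two bounds of
   [chain_bound] for [d] equal to 3. *)
pose s0 := if c pi \in m then [:: pi] else [::].
pose s := map c s0 ++
  [:: (map_poly c q1).[y1]; (map_poly c q2).[y2]; (map_poly c q3).[y3]].
have S1 : S 1 by rewrite /S rmorph1 idealr1.
have SM x y : S x -> S y -> S (x * y) by rewrite /S rmorphM; exact: notin_primeM.
have [pi0 _ _] := hpi.
have wreg := polynomial_weakly_regular S1 SM N0
  (@weakly_regular_uniformizer O S pi (c pi \in m) S1 pi0) l1 l2 l3.
have iotas : map iota s = map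
  (@polyC {poly {poly O}} \o @polyC {poly O} \o @polyC O) s0 ++
     [:: (q1 \Po 'X^N)%:P%:P; (map_poly (@polyC O) q2 \Po 'X^N)%:P;
         map_poly (@polyC {poly O} \o @polyC O) q3 \Po 'X^N].
  rewrite /s map_cat -map_comp; congr (_ ++ _); first exact: eq_map.
  have iotaq q : map_poly iota (map_poly c q) =
      map_poly (@polyC {poly {poly O}} \o @polyC {poly O} \o @polyC O) q.
    by rewrite -map_poly_comp; apply: eq_map_poly => a /=; rewrite iotac.
  rewrite /= -!(horner_map iota) !iotaq y1E y2E y3E /comp_poly.
  by congr [:: _; _; _]; rewrite -?(horner_map polyC) -?map_poly_comp.
rewrite /= -/s0 -iotas in wreg.
have sm : {subset s <= m}.
  move=> x; rewrite mem_cat => /orP[/mapP[a]|].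
    by rewrite /s0; case: ifP => // cpi; rewrite inE => /eqP-> ->.
  by rewrite !inE => /or3P[]/eqP->.
have reg := regular_sequence_loc rhoM rho1 sm _ wreg.
have {}reg : regular_sequence (map (@loc A m) s).
  by apply: reg => _ [a Sa ->]; exists (c a); rewrite ?iotac.
have dep (l : seq A) : size l = 4 -> dependent c l.
  move=> sl; apply: (dependent_inj inj0 iota0c).
  by apply: mpoly_dependent; rewrite size_map.
have c_inj : injective c.
  by move=> a b /(congr1 iota0); rewrite !iota0c => /(can_inj (@mpolyCK 3 O)).
have bound n : prime_chain (localization m) n -> (n <= size s)%N.
  move=> /prime_chain_loc[p [pp psub pneq pm]].
  have [le4 le3] := chain_bound hpi c_inj dep (fun i _ => pp i) psub pneq.
  rewrite size_cat size_map /s0; case: ifP => //= cpi.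
  by apply: le3 => /pm; rewrite cpi.
exists (size s); split; split.
- by rewrite -(size_map (@loc A m)); exact: regular_sequence_prime_chain.
- exact: bound.
- exists (map (@loc A m) s); split; rewrite ?size_map // => _ /mapP[a /sm am ->].
  by rewrite loc_in_ideal.
- by move=> n [t [<- _ /regular_sequence_prime_chain]]; exact: bound.
Qed.

Lemma eq_mpoly_rmorphism (n : nat) (O S : comNzRingType)
    (f g : {rmorphism {mpoly O[n]} -> S}) :
  (forall a, f a%:MP = g a%:MP) -> (forall i, f 'X_i = g 'X_i) -> f =1 g.
Proof.
move=> fgC fgX h; rewrite (mpolyE h) !rmorph_sum; apply: eq_bigr => m _.
rewrite -mul_mpolyC !rmorphM fgC mpolyXE_id !rmorph_prod; congr (_ * _).
by apply: eq_bigr => i _; rewrite !rmorphXn fgX.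
Qed.

(** * Invariants of diagonalizable groups *)

Section LinearSubstitution.
Variables (O : idomainType) (n : nat).

Let var (M : 'M[O]_n) := [tuple \sum_(i < n) M i j *: ('X_i : {mpoly O[n]}) | j < n].

HB.instance Definition _ (M : 'M[O]_n) :=
  GRing.RMorphism.copy (linear_subst M) (comp_mpoly (var M)).

Lemma linear_substC (M : 'M[O]_n) a : linear_subst M a%:MP = a%:MP :> {mpoly O[n]}.
Proof. exact: comp_mpolyC. Qed.

Lemma linear_substX (M : 'M[O]_n) j :
  linear_subst M 'X_j = \sum_(i < n) M i j *: ('X_i : {mpoly O[n]}).
Proof. by rewrite /linear_subst comp_mpolyXU -tnth_nth tnth_mktuple. Qed.

Lemma linear_substZ (M : 'M[O]_n) a (f : {mpoly O[n]}) :
  linear_subst M (a *: f) = a *: linear_subst M f.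
Proof. exact: comp_mpolyZ. Qed.

Lemma linear_subst_mul (A B : 'M[O]_n) (f : {mpoly O[n]}) :
  linear_subst A (linear_subst B f) = linear_subst (A *m B) f.
Proof.
apply: (eq_mpoly_rmorphism (f := linear_subst A \o linear_subst B)
  (g := linear_subst (A *m B))) f => [a|j] /=.
  by rewrite !linear_substC.
rewrite !linear_substX rmorph_sum /=.
under eq_bigr => k _ do rewrite linear_substZ linear_substX scaler_sumr.
rewrite exchange_big; apply: eq_bigr => i _ /=.
by rewrite mxE scaler_suml; apply: eq_bigr => k _; rewrite scalerA mulrC.
Qed.

Lemma linear_subst1 (f : {mpoly O[n]}) : linear_subst 1%:M f = f.
Proof.
apply: (eq_mpoly_rmorphism (f := linear_subst (1%:M : 'M[O]_n)) (g := idfun)) f =>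
  [a|j] /=.
  exact: linear_substC.
rewrite linear_substX (bigD1 j) //= mxE eqxx scale1r big1 ?addr0 // => i ij.
by rewrite mxE (negPf ij) scale0r.
Qed.

(** The scalar by which the diagonal matrix of [d] multiplies the monomial [m]. *)
Definition weight (d : 'rV[O]_n) (m : 'X_{1..n}) : O := \prod_(i < n) d 0 i ^+ m i.

Lemma weightD d m1 m2 : weight d (m1 + m2)%MM = weight d m1 * weight d m2.
Proof. by rewrite -big_split; apply: eq_bigr => i _; rewrite mnmDE exprD. Qed.

Lemma linear_subst_diag d (f : {mpoly O[n]}) m :
  (linear_subst (diag_mx d) f)@_m = weight d m * f@_m.
Proof.
have X_diag k : linear_subst (diag_mx d) 'X_[k] = weight d k *: 'X_[k].
  rewrite /linear_subst comp_mpolyX mpolyXE_id -mul_mpolyC rmorph_prod -big_split.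
  apply: eq_bigr => i _ /=; rewrite tnth_mktuple (bigD1 i) //= big1 ?addr0.
    by rewrite mxE eqxx mulr1n exprZn -mul_mpolyC.
  by move=> j ji; rewrite mxE (negPf ji) mulr0n scale0r.
rewrite {1}(mpolyE f) rmorph_sum raddf_sum /=.
rewrite [in RHS](mpolyE f) raddf_sum mulr_sumr /=; apply: eq_bigr => k _.
rewrite linear_substZ X_diag !mcoeffZ mcoeffX.
by case: eqP => [->|]; rewrite ?mulr0 // !mulr1 mulrC.
Qed.

End LinearSubstitution.

Section IteratedPolynomials.
Variable O : comNzRingType.
Local Notation P3 := {poly {poly {poly O}}}.

Definition polyC3 : {rmorphism O -> P3} := polyC \o polyC \o polyC.

Definition iter_var (i : 'I_3) : P3 := nth 0 [:: 'X%:P%:P; 'X%:P; 'X] i.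

Definition mpoly_to_iter : {rmorphism {mpoly O[3]} -> P3} := mmap polyC3 iter_var.

Definition iter_to_mpoly : {rmorphism P3 -> {mpoly O[3]}} :=
  adjoin (adjoin (adjoin (@mpolyC 3 O) 'X_(inord 0)) 'X_(inord 1)) 'X_(inord 2).

Lemma mpoly_to_iterX i : mpoly_to_iter 'X_i = iter_var i.
Proof. by rewrite /= mmapX mmap1U. Qed.

Lemma mpoly_to_iterC a : mpoly_to_iter a%:MP = a%:P%:P%:P.
Proof. exact: (mmapC iter_var polyC3). Qed.

(** Lets the retraction on [{mpoly O[3]}] be carried over to the iterated polynomial ring. *)
Lemma mpoly_to_iterK : cancel mpoly_to_iter iter_to_mpoly.
Proof.
apply: (eq_mpoly_rmorphism (f := iter_to_mpoly \o mpoly_to_iter) (g := idfun)).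
  by move=> a; rewrite /= [mmap _ _ _]mpoly_to_iterC !adjoinC.
move=> i; rewrite [LHS]/= [mmap _ _ _]mpoly_to_iterX /=.
have iE j : (j < 3)%N -> (i : nat) = j -> 'X_(inord j) = 'X_i :> {mpoly O[3]}.
  by move=> _ <-; rewrite inord_val.
case: i iE => -[|[|[|i]]] // lti iE; rewrite /iter_var /=.
- by rewrite !(adjoinC, adjoinX); exact: iE.
- by rewrite !(adjoinC, adjoinX); exact: iE.
- by rewrite !(adjoinC, adjoinX); exact: iE.
Qed.

End IteratedPolynomials.

(** * Invariants in eigenvector coordinates *)

Section DiagonalizableInvariants.
Variables (O : idomainType) (gT : finGroupType) (G : {group gT}).
Variables (rG : mx_representation O G 3) (C C' : 'M[O]_3) (d : gT -> 'rV[O]_3).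
Hypotheses (CC' : C *m C' = 1%:M) (C'C : C' *m C = 1%:M).
Hypothesis diagG : {in G, forall g, C *m rG g = diag_mx (d g) *m C}.
Local Notation R := {mpoly O[3]}.
Local Notation P3 := {poly {poly {poly O}}}.
Local Notation A := (invariant_ring rG).

Definition inv_mon (m : 'X_{1..3}) : bool := [forall g in G, weight (d g) m == 1].

Lemma inv_monD m1 m2 : inv_mon m1 -> inv_mon (m1 + m2)%MM = inv_mon m2.
Proof.
move=> /forall_inP h1; apply: eq_forallb_in => g gG.
by rewrite weightD (eqP (h1 g gG)) mul1r.
Qed.

Lemma diag_conj g : g \in G -> rG g *m C' = C' *m diag_mx (d g).
Proof.
move=> gG; rewrite -[LHS]mul1mx -C'C -mulmxA [C *m _]mulmxA diagG //.
by rewrite -[diag_mx _ *m C *m C']mulmxA CC' mulmx1.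
Qed.

Lemma linear_substCK (f : R) : linear_subst C (linear_subst C' f) = f.
Proof. by rewrite linear_subst_mul CC' linear_subst1. Qed.

Lemma linear_substC'K (f : R) : linear_subst C' (linear_subst C f) = f.
Proof. by rewrite linear_subst_mul C'C linear_subst1. Qed.

Definition invariant_diag (h : R) : Prop := forall m, h@_m != 0 -> inv_mon m.

Lemma invariant_diagP (h : R) :
  invariant_diag h -> linear_subst C' h \in invariant_poly rG.
Proof.
move=> hh; apply/invariant_polyP => g gG.
rewrite linear_subst_mul diag_conj // -linear_subst_mul; congr linear_subst.
apply/mpolyP => m; rewrite linear_subst_diag.
have [->|/hh/forall_inP/(_ g gG)/eqP->] := eqVneq h@_m 0; first by rewrite mulr0.
by rewrite mul1r.
Qed.

(** Comparing coefficients gives (weight - 1) times the coefficient equal to 0 in a domain. *)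
Lemma invariant_diag_val (a : A) : invariant_diag (linear_subst C (val a)).
Proof.
move=> m hm; apply/forall_inP => g gG.
have /invariant_polyP/(_ g gG) aG := valP a.
have := linear_subst_diag (d g) (linear_subst C (val a)) m.
rewrite linear_subst_mul -diagG // -linear_subst_mul aG => /eqP.
by rewrite -subr_eq0 -{1}[_@_m]mul1r -mulrBl mulf_eq0 (negPf hm) orbF subr_eq0 eq_sym.
Qed.

(** Takes the place of averaging over [G], whose order need not be invertible in [O]. *)
Definition proj_inv (h : R) : R := \sum_(m <- msupp h | inv_mon m) h@_m *: 'X_[m].

Lemma mcoeff_proj_inv h m : (proj_inv h)@_m = if inv_mon m then h@_m else 0.
Proof.
rewrite /proj_inv raddf_sum /=.
have [mh|mh] := boolP (m \in msupp h); last first.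
  rewrite (memN_msupp_eq0 mh) if_same big_seq_cond big1 // => k /andP[kh _].
  rewrite mcoeffZ mcoeffX; case: eqP => [km|_]; last by rewrite mulr0.
  by rewrite -km kh in mh.
rewrite big_mkcond (bigD1_seq m) //= big1 ?addr0.
  by case: ifP => // _; rewrite mcoeffZ mcoeffX eqxx mulr1.
move=> k /negPf km; case: ifP => // _.
by rewrite mcoeffZ mcoeffX km mulr0.
Qed.

Lemma proj_inv_id h : invariant_diag h -> proj_inv h = h.
Proof.
move=> hh; apply/mpolyP => m; rewrite mcoeff_proj_inv.
by case: ifP => // /negP; have [->|/hh] := eqVneq h@_m 0.
Qed.

(** Multiplying by an invariant monomial preserves both the invariance and the noninvariance of a
    monomial. *)
Lemma proj_invM h r : invariant_diag h -> proj_inv (h * r) = h * proj_inv r.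
Proof.
move=> hh; apply/mpolyP => m; rewrite mcoeff_proj_inv !mcoeffM.
case: ifPn => im.
  apply: eq_bigr => k /eqP mE; rewrite mcoeff_proj_inv.
  have [->|/hh ik] := eqVneq h@_(k.1) 0; first by rewrite !mul0r.
  by rewrite -(inv_monD _ ik) -mE im.
rewrite big1 // => k /eqP mE; rewrite mcoeff_proj_inv.
have [->|/hh ik] := eqVneq h@_(k.1) 0; first by rewrite mul0r.
by rewrite -(inv_monD _ ik) -mE (negPf im) mulr0.
Qed.

Lemma proj_inv_diag h : invariant_diag (proj_inv h).
Proof. by move=> m; rewrite mcoeff_proj_inv; case: ifP => //; rewrite eqxx. Qed.

Lemma proj_inv_is_zmod_morphism : zmod_morphism proj_inv.
Proof.
move=> h r; apply/mpolyP => m; rewrite mcoeffB !mcoeff_proj_inv mcoeffB.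
by case: ifP => // _; rewrite subr0.
Qed.

HB.instance Definition _ :=
  GRing.isZmodMorphism.Build R R proj_inv proj_inv_is_zmod_morphism.

Definition reynolds (h : R) : A := InvariantRing (invariant_diagP (@proj_inv_diag h)).

Lemma reynolds_is_zmod_morphism : zmod_morphism reynolds.
Proof. by move=> h r; apply: val_inj; rewrite raddfB /= !raddfB. Qed.

HB.instance Definition _ :=
  GRing.isZmodMorphism.Build R A reynolds reynolds_is_zmod_morphism.

Definition diag_coord : {rmorphism A -> R} := linear_subst C \o val.

Lemma diag_coord_inj : injective diag_coord.
Proof. by move=> a b /(can_inj linear_substC'K)/val_inj. Qed.

Lemma diag_coord_reynolds h : diag_coord (reynolds h) = proj_inv h.
Proof. exact: linear_substCK. Qed.

Lemma reynoldsM a r : reynolds (diag_coord a * r) = a * reynolds r.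
Proof.
apply: diag_coord_inj; rewrite rmorphM !diag_coord_reynolds.
exact/proj_invM/invariant_diag_val.
Qed.

Lemma constant_invariant (a : O) : a%:MP \in invariant_poly rG.
Proof. by apply/invariant_polyP => g _; exact: linear_substC. Qed.

Definition constant (a : O) : A := InvariantRing (constant_invariant a).

Lemma constant_is_zmod_morphism : zmod_morphism constant.
Proof. by move=> a b; apply: val_inj; rewrite raddfB /= raddfB. Qed.

Lemma constant_is_monoid_morphism : monoid_morphism constant.
Proof.
by split=> [|a b]; apply: val_inj; rewrite (rmorph1, rmorphM) //= rmorphM.
Qed.

HB.instance Definition _ :=
  GRing.isZmodMorphism.Build O A constant constant_is_zmod_morphism.
HB.instance Definition _ :=
  GRing.isMonoidMorphism.Build O A constant constant_is_monoid_morphism.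

Lemma diag_coord_constant a : diag_coord (constant a) = a%:MP.
Proof. exact: linear_substC. Qed.

Lemma weight_card g i : g \in G -> d g 0 i ^+ #|G| = 1.
Proof.
move=> gG; have diagX k : C *m rG (g ^+ k)%g = diag_mx (\row_j d g 0 j ^+ k) *m C.
  elim: k => [|k IH].
    rewrite expg0 repr_mx1 mulmx1 [diag_mx _](_ : _ = 1%:M) ?mul1mx //.
    by apply/matrixP => a b; rewrite !mxE.
  rewrite expgSr repr_mxM ?groupX // mulmxA IH -mulmxA diagG // mulmxA.
  by rewrite mulmx_diag; congr (diag_mx _ *m _); apply/rowP => j; rewrite !mxE exprSr.
have := diagX #|G|; rewrite (expg_cardG gG) repr_mx1 mulmx1 => /(congr1 (mulmx^~ C')).
rewrite -mulmxA CC' mulmx1 => /matrixP/(_ i i); rewrite !mxE eqxx => /esym.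
by rewrite mulr1n.
Qed.

(** In eigenvector coordinates this is the #|G|-th power of a variable, invariant because the
    eigenvalues are #|G|-th roots of unity. *)
Definition card_power (i : 'I_3) : A := reynolds ('X_i ^+ #|G|).

Lemma inv_mon_card (m : 'X_{1..3}) : inv_mon (m *+ #|G|)%MM.
Proof.
apply/forall_inP => g gG; apply/eqP; rewrite /weight big1 // => i _.
by rewrite mulmnE mulnC exprM weight_card // expr1n.
Qed.

Lemma diag_coord_card_power i : diag_coord (card_power i) = 'X_i ^+ #|G|.
Proof.
rewrite diag_coord_reynolds proj_inv_id // mpolyXn => m.
rewrite mcoeffX; have [<- _|] := eqVneq (U_(i) *+ #|G|)%MM m; last by rewrite eqxx.
exact: inv_mon_card.
Qed.

Lemma reynolds_monomial m : inv_mon m ->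
  reynolds 'X_[m] ^+ #|G| = \prod_(i < 3) card_power i ^+ m i.
Proof.
move=> im; apply: diag_coord_inj; rewrite rmorphXn rmorph_prod diag_coord_reynolds.
rewrite proj_inv_id => [|k]; last first.
  by rewrite mcoeffX; have [<-|] := eqVneq m k; rewrite ?eqxx.
rewrite mpolyXE_id -prodrXl; apply: eq_bigr => i _.
by rewrite rmorphXn diag_coord_card_power exprAC.
Qed.

Lemma reynolds_noninvariant m : ~~ inv_mon m -> reynolds 'X_[m] = 0.
Proof.
move=> im; apply: diag_coord_inj; rewrite rmorph0 diag_coord_reynolds.
apply/mpolyP => k; rewrite mcoeff_proj_inv mcoeff0 mcoeffX.
by case: ifP => // ik; case: eqP => // mk; rewrite mk ik in im.
Qed.

Lemma invariant_decomposition (a : A) :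
  a = \sum_(m <- msupp (diag_coord a)) constant (diag_coord a)@_m * reynolds 'X_[m].
Proof.
apply: diag_coord_inj; rewrite rmorph_sum.
have ha : invariant_diag (diag_coord a) by exact: invariant_diag_val.
rewrite -[LHS](proj_inv_id ha) {1}(mpolyE (diag_coord a)) raddf_sum.
apply: eq_bigr => m _; rewrite rmorphM diag_coord_constant diag_coord_reynolds.
rewrite -mul_mpolyC; apply: proj_invM; rewrite -diag_coord_constant.
exact: invariant_diag_val.
Qed.

Lemma integral_card_powers (E : fieldType) (phi : {rmorphism A -> E}) :
  (forall e, exists a, phi a = e) ->
  integral_over_adjoin [:: phi (card_power (inord 0)); phi (card_power (inord 1));
    phi (card_power (inord 2))] (phi \o constant).
Proof.
move=> phi_surj e; have [a <-] := phi_surj e.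
pose Phi := adjoin (adjoin (adjoin (phi \o constant) (phi (card_power (inord 0))))
  (phi (card_power (inord 1)))) (phi (card_power (inord 2))).
rewrite -[integralOver _ _]/(integralOver Phi (phi a)).
have PhiC b : Phi b%:P%:P%:P = phi (constant b) by rewrite !adjoinC.
have PhiY i : exists y, Phi y = phi (card_power i).
  have iE j : (i : nat) = j -> phi (card_power (inord j)) = phi (card_power i).
    by move=> <-; rewrite inord_val.
  case: i iE => -[|[|[|i]]] // lti iE.
  - by exists 'X%:P%:P; rewrite !(adjoinC, adjoinX) iE.
  - by exists 'X%:P; rewrite !(adjoinC, adjoinX) iE.
  - by exists 'X; rewrite !(adjoinC, adjoinX) iE.
rewrite (invariant_decomposition a) rmorph_sum.
apply: (big_ind (integralOver Phi)); [exact: integral0|exact: integral_add|].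
move=> m _; rewrite rmorphM; apply: integral_mul.
  by rewrite -PhiC; exact: integral_id.
have [im|/reynolds_noninvariant->] := boolP (inv_mon m); last first.
  by rewrite rmorph0; exact: integral0.
have /choice[y hy] := PhiY.
(* By [reynolds_monomial] an invariant monomial is a #|G|-th root of a monomial in the
   [card_power i]. *)
exists ('X^#|G| - (\prod_(i < 3) y i ^+ m i)%:P).
  by rewrite monicXnsubC ?cardG_gt0.
rewrite rmorphB /= map_polyXn map_polyC rootE !hornerE /= -rmorphXn
  reynolds_monomial //.
rewrite !rmorph_prod subr_eq0; apply/eqP; apply: eq_bigr => i _.
by rewrite !rmorphXn hy.
Qed.

Theorem cohen_macaulay_diagonalizable (pi : O) :
  is_uniformizer pi -> cohen_macaulay A.
Proof.
move=> hpi.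
have iotay i : (@mpoly_to_iter O \o diag_coord) (card_power i) = iter_var O i ^+ #|G|.
  transitivity (mpoly_to_iter O (diag_coord (card_power i))) => //.
  by rewrite diag_coord_card_power rmorphXn mpoly_to_iterX.
apply: (@cohen_macaulay_retract O A pi #|G| constant diag_coord
  (@mpoly_to_iter O \o diag_coord) (reynolds \o @iter_to_mpoly O)
  (card_power (inord 0)) (card_power (inord 1)) (card_power (inord 2))) => //.
- exact: diag_coord_inj.
- exact: diag_coord_constant.
- move=> a r; rewrite [LHS]/= rmorphM /= -[mmap _ _ _]/(mpoly_to_iter O _).
  by rewrite mpoly_to_iterK; exact: reynoldsM.
- rewrite /= rmorph1; apply: diag_coord_inj; rewrite diag_coord_reynolds rmorph1.
  rewrite proj_inv_id // => m; rewrite mcoeff1.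
  have [-> _|] := eqVneq m 0%MM; rewrite ?eqxx //.
  by apply/forall_inP => g _; rewrite /weight big1 // => i _; rewrite mnmE expr0.
- move=> a; transitivity (mpoly_to_iter O (diag_coord (constant a))) => //.
  by rewrite diag_coord_constant mpoly_to_iterC.
- by apply: etrans (iotay _) _; rewrite /iter_var inordK //= !rmorphXn.
- by apply: etrans (iotay _) _; rewrite /iter_var inordK //= !rmorphXn.
- by apply: etrans (iotay _) _; rewrite /iter_var inordK.
- exact: integral_card_powers.
Qed.

End DiagonalizableInvariants.

(** * Groups congruent to 1 modulo zeta_p - 1 *)

Section PrimeRootOfUnity.
Variables (O : idomainType) (lam : O).
Local Notation z := (1 + lam).

(** This is (z^i - 1) / lam as a geometric sum; it is congruent to i modulo lam. *)
Definition root_slope (i : nat) : O := \sum_(j < i) z ^+ j.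

Lemma root_slopeE i : z ^+ i = 1 + lam * root_slope i.
Proof.
rewrite -[LHS](subrK 1) subrX1 addrC; congr (1 + _ * _).
by rewrite addrC addKr.
Qed.

Hypothesis lam0 : lam != 0.
Variable p : nat.
Hypotheses (hp : prime p) (zp : z ^+ p = 1).

(** In the fraction field z has order exactly p, as p is prime and z is not 1; the factorization
    holds there. *)
Lemma prod_XsubC_roots : \prod_(i < p) ('X - (z ^+ i)%:P) = 'X^p - 1 :> {poly O}.
Proof.
have prim : p.-primitive_root (tofrac z).
  have [|m pm mp] := @prim_order_exists _ p (tofrac z) (prime_gt0 hp).
    by rewrite -rmorphXn zp rmorph1.
  have /primeP[_ /(_ _ mp)/orP[/eqP m1|/eqP <- //]] := hp.
  have := prim_expr_order pm; rewrite m1 expr1 => /eqP.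
  rewrite -(rmorph1 (@tofrac O)) tofrac_eq addrC -subr_eq0 addrK.
  by rewrite (negPf lam0).
apply: (map_inj_poly (f := @tofrac O)) => //; first by move=> a b /eqP;
  rewrite tofrac_eq => /eqP.
rewrite rmorph_prod rmorphB /= map_polyXn rmorph1 -(factor_Xn_sub_1 prim) big_mkord.
by apply: eq_bigr => i _; rewrite rmorphB /= map_polyX map_polyC /= rmorphXn.
Qed.

(** The identity 1 + X + ... + X^(p-1) = prod (X - z^i), over 0 < i < p, evaluated at 1. *)
Lemma natr_prime_factor : p%:R = lam ^+ p.-1 * \prod_(i < p.-1) - root_slope i.+1.
Proof.
have := prod_XsubC_roots; rewrite subrX1 -(prednK (prime_gt0 hp)) big_ord_recl expr0.
move=> /(mulfI (negbT (polyXsubC_eq0 1))) /(congr1 (horner^~ 1)).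
rewrite horner_prod horner_sum => E.
transitivity (\sum_(i < p.-1.+1) ('X^i).[1] : O).
  rewrite (eq_bigr (fun=> 1)) => [|i _]; last by rewrite hornerXn expr1n.
  by rewrite sumr_const card_ord.
rewrite -E -[X in lam ^+ X]card_ord -prodrMl; apply: eq_bigr => i _.
by rewrite hornerXsubC root_slopeE opprD addNKr mulrN.
Qed.

End PrimeRootOfUnity.

Lemma exprD1_quadratic (B : nzRingType) (x : B) m :
  exists W, (1 + x) ^+ m = 1 + x *+ m + x ^+ 2 * W.
Proof.
elim: m => [|m [W IH]]; first by exists 0; rewrite mulr0 mulr0n !addr0.
exists (W * (1 + x) + m%:R).
have xm : (1 + x *+ m) * (1 + x) = 1 + x *+ m.+1 + x ^+ 2 *+ m.
  by rewrite mulrDl mul1r mulrDr mulr1 mulrnAl -expr2 mulrS !addrA.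
by rewrite exprSr IH mulrDl xm -mulrA
  (mulrDr _ (W * _)) mulr_natr -!addrA [_ *+ m + _]addrC.
Qed.

Lemma row_diag_mul (B : nzRingType) m n (d : 'rV[B]_m) (X : 'M[B]_(m, n)) i :
  row i (diag_mx d *m X) = d 0 i *: row i X.
Proof. by rewrite row_mul row_diag_mx -scalemxAl -rowE. Qed.

(** * Simultaneous diagonalization, lifted from the residue field *)

Section ResidueDiagonalization.
Variables (O : idomainType) (lam : O) (p : nat).
Variables (k : fieldType) (phi : {rmorphism O -> k}).
Hypotheses (hlam : is_uniformizer lam) (hp : prime p).
Hypothesis zp : (1 + lam) ^+ p = 1.
Hypothesis phi0 : forall a, phi a = 0 <-> exists b, a = lam * b.
Hypothesis phi_surj : forall e, exists a, phi a = e.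
Local Notation z := (1 + lam).
Local Notation root_slope := (root_slope lam).

Lemma lam_neq0 : lam != 0. Proof. by case: hlam. Qed.

Lemma phi_lam : phi lam = 0.
Proof. by apply/phi0; exists 1; rewrite mulr1. Qed.

Lemma phi_z : phi z = 1.
Proof. by rewrite rmorphD rmorph1 phi_lam addr0. Qed.

Lemma unit_of_phi a : phi a != 0 -> a \is a GRing.unit.
Proof.
have [_ _ dvr] := hlam; move=> pa.
have a0 : a != 0 by apply: contraNneq pa => ->; rewrite rmorph0.
have [u [[|n] [uU aE]]] := dvr _ a0; first by rewrite aE mulr1.
by move: pa; rewrite aE exprS rmorphM rmorphM phi_lam mul0r mulr0 eqxx.
Qed.

Lemma phi_root_slope i : phi (root_slope i) = i%:R.
Proof.
rewrite rmorph_sum (eq_bigr (fun=> 1)) => [|j _];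
  first by rewrite sumr_const card_ord.
by rewrite rmorphXn phi_z expr1n.
Qed.

(** z^p = 1 makes the slope of index p vanish, and its residue is p. *)
Lemma phi_p : p%:R = 0 :> k.
Proof.
rewrite -phi_root_slope; have := root_slopeE lam p; rewrite zp -{1}[1]addr0.
move=> /addrI/esym/eqP; rewrite mulf_eq0 (negPf lam_neq0) /= => /eqP->.
exact: rmorph0.
Qed.

Lemma phi_nat_neq0 i : (0 < i < p)%N -> i%:R != 0 :> k.
Proof.
move=> /andP[i0 ltip]; apply/eqP => iE.
have pc : p \in [pchar k] by rewrite inE hp phi_p eqxx.
by move/eqP: iE; rewrite -(dvdn_pcharf pc) gtnNdvd.
Qed.

Lemma phi_root_slope_inj i j : (i < p)%N -> (j < p)%N ->
  phi (root_slope i) = phi (root_slope j) -> i = j.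
Proof.
wlog leij : i j / (i <= j)%N.
  move=> th lti ltj ij; have [leij|/ltnW leji] := leqP i j; first exact: th.
  by apply/esym/th.
move=> lti ltj; rewrite !phi_root_slope => /esym/eqP.
rewrite -subr_eq0 -natrB //; move: leij; rewrite leq_eqVlt => /predU1P[//|ltij].
by rewrite (negPf (phi_nat_neq0 _)) // subn_gt0 ltij (leq_ltn_trans (leq_subr _ _)).
Qed.

Variable n : nat.
Local Notation M := 'M[O]_n.+1.

Lemma prod_roots_mx (X : M) : X ^+ p = 1 -> \prod_(i < p) (X - (z ^+ i)%:M) = 0.
Proof.
move=> Xp; have := congr1 (horner_mx X) (prod_XsubC_roots lam_neq0 hp zp).
rewrite rmorphB rmorphXn rmorph1 /= horner_mx_X Xp subrr rmorph_prod => <-.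
by apply: eq_bigr => i _; rewrite rmorphB /= horner_mx_X horner_mx_C.
Qed.

Lemma scale_lam_inj k0 : injective (fun X : M => lam ^+ k0 *: X).
Proof.
move=> X Y XY; apply/matrixP => i j; move/matrixP/(_ i j): XY; rewrite !mxE.
by apply: mulfI; rewrite expf_neq0 // lam_neq0.
Qed.

Lemma unitmx_phi (X : M) : map_mx phi X \in unitmx -> X \in unitmx.
Proof.
by rewrite !unitmxE det_map_mx unitfE; exact: unit_of_phi.
Qed.

(* Every factor [X - z ^ i] with [0 < i < p] is [lam] times an invertible
   matrix. *)
Lemma order_p_congruent1 (X Y : M) : X ^+ p = 1 -> X = 1 + lam ^+ 2 *: Y -> X = 1.
Proof.
move=> Xp XE; have := prod_roots_mx Xp.
rewrite -(prednK (prime_gt0 hp)) big_ord_recl expr0.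
pose U i : M := lam *: Y - (root_slope i)%:M.
have -> : \prod_(i < p.-1) (X - (z ^+ lift ord0 i)%:M) =
    lam ^+ p.-1 *: \prod_(i < p.-1) U i.+1.
  rewrite -[X in lam ^+ X]card_ord -scaler_prodl; apply: eq_bigr => i _.
  rewrite XE root_slopeE /U scalerBr scalerA -expr2 scale_scalar_mx.
  by rewrite [(1 + _)%:M]raddfD /= opprD addrACA subrr add0r.
have Uunit : \prod_(i < p.-1) U i.+1 \is a GRing.unit.
  apply: rpred_prod => i _; apply: unitmx_phi.
  rewrite /U map_mxD map_mxN map_mxZ phi_lam scale0r add0r map_scalar_mx.
  rewrite -raddfN /= unitmxE det_scalar unitrX // unitrN unitfE phi_root_slope.
  by apply: phi_nat_neq0; rewrite /= -ltn_predRL.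
rewrite -scalerAr -(scaler0 _ (lam ^+ p.-1)) => /scale_lam_inj XU.
apply/eqP; rewrite -subr_eq0; apply/eqP.
by apply: (mulIr Uunit); rewrite mul0r.
Qed.

(** The linear term p lam Y is divisible by lam^2 because lam divides p. *)
Lemma exp_p_congruent1 (Y : M) : exists Z : M,
  (1 + lam *: Y) ^+ p = 1 + lam ^+ 2 *: Z.
Proof.
have [W ->] := exprD1_quadratic (lam *: Y) p.
have [b pE] : exists b, p%:R = lam * b.
  by apply/phi0; rewrite rmorph_nat phi_p.
exists (b *: Y + Y ^+ 2 * W); rewrite -addrA; congr (1 + _).
rewrite scalerDr -scaler_nat pE !scalerA exprZn -scalerAl; congr (_ *: _ + _).
by rewrite mulrAC.
Qed.

Variables (gT : finGroupType) (G : {group gT}) (rG : mx_representation O G n.+1).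
Hypothesis pG : (p.-group G)%g.
Variable h : gT -> M.
Hypothesis rGE : forall g, g \in G -> rG g = 1 + lam *: h g.

Lemma repr_mxX_ring g i : g \in G -> rG (g ^+ i)%g = rG g ^+ i.
Proof.
move=> gG; elim: i => [|i IH]; first by rewrite expg0 repr_mx1 expr0.
by rewrite expgSr exprSr repr_mxM ?groupX // IH.
Qed.

(** A p-th power of an element of the group is 1 modulo lam^2, so it is 1 as soon as its own p-th
    power is. This lowers the exponent from p^(e+2) to p^(e+1), down to p. *)
Lemma repr_exponent g : g \in G -> rG g ^+ p = 1.
Proof.
move=> gG; have /p_natP[e oe] := mem_p_elt pG gG.
have : rG g ^+ (p ^ e) = 1.
  by rewrite -repr_mxX_ring // -oe expg_order repr_mx1.
case: e {oe} => [|e].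
  by rewrite expn0 expr1 => ->; rewrite expr1n.
elim: e => // e IH; rewrite !expnSr !exprM => ge; apply: IH.
rewrite expnSr exprM.
have [Z ZE] := exp_p_congruent1 (h (g ^+ (p ^ e))%g).
rewrite -repr_mxX_ring // rGE ?groupX // in ge *.
exact: order_p_congruent1 ge ZE.
Qed.

(** The commutator is 1 modulo lam^2 and has exponent p, hence is trivial. *)
Lemma repr_comm g1 g2 : g1 \in G -> g2 \in G -> rG g1 * rG g2 = rG g2 * rG g1.
Proof.
move=> g1G g2G; pose c := [~ g1, g2]%g; have cG : c \in G by rewrite groupR.
have E : rG g1 * rG g2 = rG g2 * rG g1 * rG c.
  have -> : rG g1 * rG g2 = rG (g1 * g2)%g by rewrite repr_mxM.
  have -> : rG g2 * rG g1 = rG (g2 * g1)%g by rewrite repr_mxM.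
  by rewrite commgC [LHS]repr_mxM //; exact: groupM.
have U : rG g2 * rG g1 \is a GRing.unit.
  by rewrite -repr_mxMr // repr_mx_unit // groupM.
have cE : rG c = 1 + lam ^+ 2 *: ((rG g2 * rG g1)^-1 * (h g1 * h g2 - h g2 * h g1)).
  apply: (mulrI U); rewrite -E mulrDr mulr1 -scalerAr mulVKr //.
  rewrite !rGE // !mulrDl !mulrDr !mul1r !mulr1 -!scalerAl -!scalerAr !scalerA.
  rewrite -expr2 scalerBr -!addrA; congr (_ + _).
  rewrite [RHS]addrCA; congr (_ + _); congr (_ + _).
  by rewrite addrC subrK.
by rewrite E (order_p_congruent1 (repr_exponent cG) cE) mulr1.
Qed.

Lemma slope_comm g1 g2 : g1 \in G -> g2 \in G -> h g1 * h g2 = h g2 * h g1.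
Proof.
move=> g1G g2G; apply: (@scale_lam_inj 2); have := repr_comm g1G g2G.
rewrite !rGE // !mulrDl !mulrDr !mul1r !mulr1 -!scalerAl -!scalerAr !scalerA -expr2.
by rewrite -!addrA => /addrI; rewrite addrCA => /addrI/addrI.
Qed.

Lemma slope_roots g : g \in G -> \prod_(i < p) (h g - (root_slope i)%:M) = 0.
Proof.
move=> gG; apply: (@scale_lam_inj p); rewrite scaler0.
rewrite -(prod_roots_mx (repr_exponent gG)) -[X in lam ^+ X]card_ord -scaler_prodl.
apply: eq_bigr => i _; rewrite rGE // root_slopeE scalerBr scale_scalar_mx.
by rewrite [(1 + _)%:M]raddfD /= opprD addrACA subrr add0r.
Qed.

Let hbar g := map_mx phi (h g).

Lemma hbar_roots g : g \in G ->
  \prod_(i < p) (hbar g - (phi (root_slope i))%:M) = 0.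
Proof.
move=> gG; have /(congr1 (map_mx phi)) := slope_roots gG.
rewrite map_mx0 => <-; rewrite rmorph_prod; apply: eq_bigr => i _.
by rewrite rmorphB /= map_scalar_mx.
Qed.

(** The residues of the slopes commute, and each is killed by a split polynomial with distinct
    roots. *)
Lemma hbar_codiagonalizable : exists2 P, P \in unitmx &
  forall g, g \in G -> exists D, P *m hbar g = diag_mx D *m P.
Proof.
have [|P Punit /allP PD] := (codiagonalizableP [seq hbar g | g <- enum G]).1.
  split=> [_ _ /mapP[g1 + ->] /mapP[g2 + ->]|_ /mapP[g + ->]].
    rewrite !mem_enum => g1G g2G; rewrite /comm_mx -!map_mxM; congr map_mx.
    exact: slope_comm.
  rewrite mem_enum => gG; apply/diagonalizableP.
  exists [seq phi (root_slope i) | i : 'I_p].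
    rewrite map_inj_uniq ?enum_uniq // => i j ij; apply/val_inj.
    exact: phi_root_slope_inj ij.
  apply: mxminpoly_min; rewrite big_map big_enum rmorph_prod /= -[RHS](hbar_roots gG).
  by apply: eq_bigr => i _; rewrite rmorphB /= horner_mx_X horner_mx_C.
exists P => // g gG; have /PD/= : hbar g \in [seq hbar g | g <- enum G].
  by apply: map_f; rewrite mem_enum.
by move=> /similar_diagPex[D /(similarP Punit) PgD]; exists D.
Qed.

Lemma horner_mx_eigen (B : comNzRingType) m (X : 'M[B]_m.+1) (v : 'rV_m.+1) a q :
  v *m X = a *: v -> v *m horner_mx X q = q.[a] *: v.
Proof.
move=> vX; elim/poly_ind: q => [|q b IH].
  by rewrite rmorph0 horner0 mulmx0 scale0r.
rewrite rmorphD rmorphM /= horner_mx_X horner_mx_C hornerMXaddC mulmxDr.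
rewrite -[horner_mx X q * X]/(_ *m _) mulmxA IH -scalemxAl vX scalerA mul_mx_scalar.
by rewrite -scalerDl.
Qed.

Let others (i : 'I_p) : {poly O} := \prod_(j < p | j != i) ('X - (root_slope j)%:P).

(** An unnormalized Lagrange projector onto the eigenspace of [h g] for the i-th slope. *)
Let idem g i : M := horner_mx (h g) (others i).

Lemma idem_root g i : g \in G -> idem g i *m h g = root_slope i *: idem g i.
Proof.
move=> gG; apply/eqP; rewrite -mul_scalar_mx -subr_eq0 -scalar_mxC -mulmxBr;
  apply/eqP.
rewrite -(slope_roots gG) /idem.
transitivity (horner_mx (h g) (others i * ('X - (root_slope i)%:P))).
  by rewrite rmorphM rmorphB /= horner_mx_X horner_mx_C.
have <- : \prod_(j < p) ('X - (root_slope j)%:P)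
  = others i * ('X - (root_slope i)%:P).
  by rewrite (bigD1 i) //= mulrC.
rewrite rmorph_prod; apply: eq_bigr => j _.
by rewrite rmorphB /= horner_mx_X horner_mx_C.
Qed.

(** The projectors of the elements of [gs] are applied in turn. Each preserves the eigenvector
    equations already obtained, since slopes commute, and multiplies the residue by a nonzero
    scalar. *)
Lemma lift_eigenvector (v : 'rV[O]_n.+1) (chi : gT -> 'I_p) (gs : seq gT) :
  {subset gs <= G} ->
  (forall g, g \in G ->
     map_mx phi v *m hbar g = phi (root_slope (chi g)) *: map_mx phi v) ->
  exists2 v' : 'rV[O]_n.+1,
    exists2 a, a != 0 & map_mx phi v' = a *: map_mx phi v &
    {in gs, forall g, v' *m h g = root_slope (chi g) *: v'}.
Proof.
move=> sG hv; elim: gs sG => [|g gs IH] sG.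
  by exists v => //; exists 1; rewrite ?oner_neq0 ?scale1r.
have [|v' [a a0 v'E] hv'] := IH; first by move=> x xs; apply: sG; rewrite inE xs orbT.
have gG : g \in G by apply: sG; rewrite mem_head.
exists (v' *m idem g (chi g)).
  exists (a * (map_poly phi (others (chi g))).[phi (root_slope (chi g))]).
    rewrite mulf_neq0 // rmorph_prod horner_prod; apply/prodf_neq0 => j jchi /=.
    rewrite rmorphB /= map_polyX map_polyC hornerXsubC subr_eq0.
    apply: contra jchi => /eqP E; apply/eqP/val_inj/esym.
    exact: phi_root_slope_inj (ltn_ord _) (ltn_ord _) E.
  rewrite map_mxM map_horner_mx v'E -scalemxAl (horner_mx_eigen _ (hv g gG)).
  by rewrite scalerA.
move=> g'; rewrite inE => /predU1P[->|g's].
  by rewrite -mulmxA idem_root // -scalemxAr.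
have g'G : g' \in G by apply: sG; rewrite inE g's orbT.
have cgg : comm_mx (h g') (idem g (chi g)).
  by apply: comm_mx_horner; exact: slope_comm.
by rewrite -mulmxA -cgg mulmxA hv' // scalemxAl.
Qed.

Theorem simultaneous_diagonalization : exists2 C : M, C \in unitmx &
  exists d : gT -> 'rV[O]_n.+1, {in G, forall g, C *m rG g = diag_mx (d g) *m C}.
Proof.
have [P Punit hP] := hbar_codiagonalizable.
have row_neq0 j : row j P != 0.
  apply: contraTneq Punit => Pj; rewrite -row_free_unit; apply/row_freePn.
  by exists j; rewrite Pj sub0mx.
have /choice[chi hchi] : forall jg : 'I_n.+1 * gT, exists i : 'I_p, jg.2 \in G ->
    row jg.1 P *m hbar jg.2 = phi (root_slope i) *: row jg.1 P.
  move=> [j g] /=; have [gG|gG] := boolP (g \in G); last first.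
    by exists (Ordinal (prime_gt0 hp)).
  have [D PD] := hP g gG.
  have rD : row j P *m hbar g = D 0 j *: row j P.
    by rewrite -row_mul PD row_diag_mul.
  have := horner_mx_eigen (\prod_(i < p) ('X - (phi (root_slope i))%:P)) rD.
  rewrite rmorph_prod (eq_bigr (fun i : 'I_p => hbar g - (phi (root_slope i))%:M)).
    rewrite hbar_roots // mulmx0 => /esym/eqP;
      rewrite scaler_eq0 (negPf (row_neq0 j)).
    rewrite orbF horner_prod => /prodf_eq0[i _].
    by rewrite hornerXsubC subr_eq0 => /eqP Di; exists i; rewrite rD Di.
  by move=> i _; rewrite rmorphB /= horner_mx_X horner_mx_C.
have /choice[w hw] : forall j, exists v' : 'rV[O]_n.+1,
    (exists2 a, a != 0 & map_mx phi v' = a *: row j P) /\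
    {in enum G, forall g, v' *m h g = root_slope (chi (j, g)) *: v'}.
  move=> j; have /choice[v hv] := fun i => phi_surj (P j i).
  have vE : map_mx phi (\row_i v i) = row j P by apply/rowP => i; rewrite !mxE hv.
  have [||v' h1 h2] := @lift_eigenvector (\row_i v i) (fun g => chi (j, g)) (enum G).
  - by move=> g; rewrite mem_enum.
  - by move=> g gG; rewrite vE; exact: (hchi (j, g) gG).
  - by exists v'; rewrite -vE.
have /choice[a ha] : forall j, exists a, a != 0 /\ map_mx phi (w j) = a *: row j P.
  by move=> j; have [[a a0 aE] _] := hw j; exists a.
exists (\matrix_j w j).
  (* The residues of the lifted rows are nonzero multiples of the rows of [P], so the residue matrix
     is invertible. *)
  apply: unitmx_phi; have -> : map_mx phi (\matrix_j w j) = diag_mx (\row_j a j) *m P.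
    apply/row_matrixP => j; rewrite row_diag_mul mxE -(ha j).2.
    by rewrite -map_row rowK.
  rewrite unitmx_mul Punit andbT unitmxE det_diag unitfE; apply/prodf_neq0 => j _.
  by rewrite mxE; case: (ha j).
exists (fun g => \row_j (1 + lam * root_slope (chi (j, g)))) => g gG.
apply/row_matrixP => j; rewrite row_mul rowK row_diag_mul mxE rowK rGE //.
rewrite mulmxDr mulmx1 -scalemxAr (hw j).2 ?mem_enum // scalerA scalerDl scale1r.
by [].
Qed.

End ResidueDiagonalization.

(** * Localized rings of integers *)

Section LocallyPrincipal.
Variables (A : idomainType) (P : prime_idealr A) (q : A) (L : seq A).
Hypotheses (q0 : q != 0) (qP : q \in P).
Hypothesis finite_mod : forall a, exists2 x, x \in L & exists b, a = x + q * b.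
(* [y / q] is a root of the monic polynomial [X ^ j - X ^ i - b]. *)
Hypothesis integrally_closed : forall (y b : A) i j, (i < j)%N ->
  y ^+ j = q ^+ (j - i) * y ^+ i + q ^+ j * b -> exists c, y = q * c.

Lemma pigeonhole_mod (f : nat -> A) : exists i j, (i < j)%N /\ exists b,
  f j = f i + q * b.
Proof.
have /choice[g hg] : forall i, exists x, x \in L /\ exists b, f i = x + q * b.
  by move=> i; have [x xL hx] := finite_mod (f i); exists x.
have /(uniqPn 0)[i [j [ltij ltj gE]]] : ~~ uniq (mkseq g (size L).+1).
  apply/negP => u; have := @uniq_leq_size _ _ L u.
  rewrite size_mkseq ltnn => sub; suff : false by [].
  by apply: sub => _ /mapP[i _ ->]; have [] := hg i.
rewrite size_mkseq in ltj; exists i, j; split=> //.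
rewrite !nth_mkseq // in gE; last exact: ltn_trans ltj.
have [_ [b ->]] := hg i; have [_ [c ->]] := hg j.
by exists (c - b); rewrite gE; ring.
Qed.

(** Two powers of w agree modulo q, so w^i (1 - w^(j-i)) lies in [P], and w^i does not. *)
Lemma invertible_mod (w : A) : w \notin P -> exists w', 1 - w * w' \in P.
Proof.
move=> wP; have [i [j [ltij [b wE]]]] := pigeonhole_mod (fun i => w ^+ i).
exists (w ^+ (j - i).-1); rewrite -exprS prednK ?subn_gt0 //.
have : w ^+ i * (1 - w ^+ (j - i)) \in P.
  rewrite mulrBr mulr1 -exprD subnKC 1?ltnW // wE.
  by rewrite opprD addNKr rpredN mulrC idealMr.
rewrite prime_idealrM => /orP[wi|//].
by case/negP: wP; apply: prime_X (prime_idealr_is_prime P) wi.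
Qed.

(** The class of [y] in A / q stays nonzero after localization at [P]. *)
Let torsion_free y := forall t b, t \notin P -> t * y <> q * b.

(** For each v, y is multiplied by the highest power of v that keeps it nonzero in the localization
    of A / q. Some power kills it: v^i (v^(j-i) - 1) lies in (q), and the second factor is outside
    [P]. *)
Lemma exists_annihilated (l : seq A) : {subset l <= P} ->
  exists y, torsion_free y /\ {in l, forall v, exists b, v * y = q * b}.
Proof.
elim: l => [_|v l IH lP].
  exists 1; split=> // t b tP; rewrite mulr1 => tE; move: tP.
  by rewrite tE mulrC idealMr.
have [|y [tfy hy]] := IH; first by move=> x xl; apply: lP; rewrite inE xl orbT.
have vP : v \in P by apply: lP; rewrite mem_head.
have ex_k : exists k, `[< ~ torsion_free (v ^+ k * y) >].
  have [i [j [ltij [b vE]]]] := pigeonhole_mod (fun i => v ^+ i).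
  exists i; apply/asboolP => tf; apply: (tf (v ^+ (j - i) - 1) (b * y)).
    apply/negP => h; have : (1 : A) \in P.
      rewrite -(subKr (v ^+ (j - i)) 1) rpredB // -(subnSK ltij) exprS mulrC.
      exact: idealMr.
    by rewrite idealr1.
  have E : (v ^+ (j - i) - 1) * v ^+ i = q * b.
    by rewrite mulrBl mul1r -exprD subnK 1?ltnW // vE addrC addKr.
  by rewrite [RHS]mulrA -E -mulrA.
case: (ex_minnP ex_k) => -[|k] /asboolP ntf mink; first by case: ntf; rewrite mul1r.
have tfk : torsion_free (v ^+ k * y).
  by apply: contrapT => ntfk; have := mink k; rewrite ltnn => /(_ (asboolT ntfk)).
have [t [tP [b tb]]] : exists t, t \notin P /\ exists b, t * (v ^+ k.+1 * y) = q * b.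
  apply: contrapT => no; apply: ntf => t b tP tb; apply: no.
  by exists t; split=> //; exists b.
exists (t * (v ^+ k * y)); split.
  move=> u c uP; rewrite mulrA; apply: tfk; exact: notin_primeM.
move=> x; rewrite inE => /predU1P[->|xl].
  by exists b; rewrite -tb exprS; ring.
have [c xy] := hy x xl; exists (t * v ^+ k * c).
by rewrite [RHS]mulrCA -xy; ring.
Qed.

(** Some y satisfies P y in (q) while y / q is not in A_P. If y / q maps an element x of [P] outside
    [P], then x generates P A_P. Otherwise y / q maps [P] into itself, is therefore integral, and y
    lies in (q), a contradiction. *)
Lemma exists_local_generator : exists x w, [/\ x \in P, w \notin P &
  forall v, v \in P -> exists v', v * w = x * v'].
Proof.
have [|y [tfy hy]] := @exists_annihilated [seq x <- L | x \in P].
  by move=> x; rewrite mem_filter => /andP[].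
have {}hy v : v \in P -> exists b, v * y = q * b.
  move=> vP; have [x xL [b vE]] := finite_mod v.
  have xP : x \in P by rewrite -(addrK (q * b) x) -vE rpredB // mulrC idealMr.
  have [|c xy] := hy x; first by rewrite mem_filter xP.
  by exists (c + b * y); rewrite vE mulrDl xy; ring.
have [[x [w [xP wP xy]]]|no] :=
  pselect (exists x w, [/\ x \in P, w \notin P & x * y = q * w]).
  exists x, w; split=> // v vP; have [v' vy] := hy v vP; exists v'.
  by apply: (mulfI q0); rewrite mulrCA -xy mulrCA vy; ring.
have /choice[nx hnx] : forall v, exists v', v \in P -> v' \in P /\ v * y = q * v'.
  move=> v; have [vP|vP] := boolP (v \in P); last by exists 0.
  have [v' vy] := hy v vP; exists v' => _; split=> //.
  by apply: contrapT => /negP v'P; apply: no; exists v, v'.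
(* [a i] is (y / q)^i q; two of these agreeing modulo q yield a monic equation for y / q. *)
pose a i := iter i nx q.
have aP i : a i \in P by elim: i => // i IH; have [] := hnx _ IH.
have aE i : q ^+ i * a i = q * y ^+ i.
  elim: i => [|i IH]; first by rewrite mul1r mulr1.
  rewrite [a _]/=; have [_ e] := hnx _ (aP i).
  by rewrite exprSr -mulrA -e mulrA IH exprSr mulrA.
have [i [j [ltij [b ab]]]] := pigeonhole_mod a.
have [c yc] : exists c, y = q * c.
  apply: (@integrally_closed y b i j ltij); apply: (mulfI q0).
  rewrite -aE ab mulrDr.
  have -> : q ^+ j = q ^+ (j - i) * q ^+ i by rewrite -exprD subnK // ltnW.
  by rewrite -[_ * a i]mulrA aE; ring.
by case: (tfy 1 c); rewrite ?notin_prime1 ?mul1r.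
Qed.

End LocallyPrincipal.

(** * Integer relations and finiteness modulo p *)

Section RationalCoordinates.
Variables (V : zmodType) (N : nat) (f : {additive V -> 'rV[rat]_N}).
Hypothesis f_inj : injective f.
Variable p : nat.
Hypothesis hp : prime p.

(** A relation divisible by p may be divided by p, as [V] has no torsion; the sum of the absolute
    values decreases. *)
Lemma int_primitive_multiple (m : nat) (a : 'I_m -> V) (c : 'I_m -> int) :
  (exists i, c i != 0) -> \sum_i a i *~ c i = 0 ->
  exists2 d : 'I_m -> int, \sum_i a i *~ d i = 0 & exists i, ~~ (p %| d i)%Z.
Proof.
move sE : (\sum_i absz (c i))%N => s; elim/ltn_ind: s c sE => s IH c sE [i0 ci0] rel.
have [/forallP pc|/existsP[i pi]] := boolP [forall i, (p %| c i)%Z]; last first.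
  by exists c => //; exists i.
pose d i := (c i %/ p)%Z.
have cE i : c i = d i * p by rewrite divzK.
have p1 := prime_gt1 hp.
have di0 : d i0 != 0 by apply: contraNneq ci0 => d0; rewrite cE d0 mul0r.
apply: (IH (\sum_i absz (d i))%N _ d) => //; last 1 [by exists i0|].
  rewrite -sE (bigD1 i0) //= [X in (_ < X)%N](bigD1 i0) //= -addSn leq_add //.
    by rewrite cE abszM ltn_Pmulr // absz_gt0.
  by apply: leq_sum => i _; rewrite cE abszM leq_pmulr // ltnW.
apply: f_inj; rewrite raddf0; apply/eqP.
have : f (\sum_i a i *~ c i) == 0 by rewrite rel raddf0.
have -> : \sum_i a i *~ c i = (\sum_i a i *~ d i) *+ p.
  rewrite -sumrMnl; apply: eq_bigr => i _; rewrite cE mulrzA.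
  by rewrite -pmulrn.
rewrite raddfMn /= -scaler_nat scaler_eq0 pnatr_eq0.
by rewrite eqn0Ngt prime_gt0.
Qed.

Lemma int_relation (m : nat) (a : 'I_m -> V) : (N < m)%N ->
  exists2 d : 'I_m -> int, \sum_i a i *~ d i = 0 & exists i, ~~ (p %| d i)%Z.
Proof.
move=> ltNm; have [v v0 vM] := left_kernel_nonzero (\matrix_i f (a i)) ltNm.
pose D : int := \prod_i denq (v 0 i).
pose c i := numq (v 0 i) * \prod_(j | j != i) denq (v 0 j).
have D0 : D != 0 by apply/prodf_neq0 => i _; exact: denq_neq0.
have cE i : (c i)%:~R = D%:~R * v 0 i :> rat.
  have dv : (denq (v 0 i))%:~R * v 0 i = (numq (v 0 i))%:~R.
    by rewrite -{2}[v 0 i]divq_num_den mulrCA divff ?mulr1 // intr_eq0 denq_neq0.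
  by rewrite /c /D [in RHS](bigD1 i) //= !intrM mulrAC dv.
apply: (int_primitive_multiple (c := c)).
  have [i vi] : exists i, v 0 i != 0 by apply/rV0Pn.
  by exists i; rewrite -(intr_eq0 rat) cE mulf_neq0 // intr_eq0.
apply: f_inj; rewrite raddf0 raddf_sum /=.
transitivity (D%:~R *: (v *m \matrix_i f (a i))); last by rewrite vM scaler0.
rewrite mulmx_sum_row scaler_sumr; apply: eq_bigr => i _.
by rewrite rowK raddfMz -scaler_int cE scalerA.
Qed.

End RationalCoordinates.

Lemma prime_bezoutz (p : nat) (c : int) :
  prime p -> ~~ (p %| c)%Z -> exists u v : int, u * c + v * p = 1.
Proof.
move=> hp pc; have /coprimezP[[u v] /= uv] : coprimez c p.
  by rewrite coprimezE coprime_sym prime_coprime.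
by exists u, v.
Qed.

(** A family independent modulo p has at most [N] members by [int_relation]; one of maximal size
    spans A / p. *)
Lemma finite_mod_prime (A : comNzRingType) (N : nat) (f : {additive A -> 'rV[rat]_N})
    (p : nat) : injective f -> prime p ->
  exists L : seq A, forall a, exists2 x, x \in L & exists b, a = x + p%:R * b.
Proof.
move=> f_inj hp; have p_gt0 := prime_gt0 hp.
pose indep m (s : 'I_m -> A) := forall (c : 'I_m -> int) b,
  \sum_i s i *~ c i = p%:R * b -> forall i, (p %| c i)%Z.
pose E m := `[< exists s : 'I_m -> A, indep m s >].
have E0 : exists m, E m.
  by exists 0%N; apply/asboolP; exists (fun=> 0) => c b _ [].
have EN m : E m -> (m <= N)%N.
  move=> /asboolP[s ind]; rewrite leqNgt; apply/negP => ltNm.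
  have [d rel [i pi]] := int_relation f_inj hp s ltNm.
  by move: pi; rewrite (ind d 0) // mulr0.
case: (ex_maxnP E0 EN) => m /asboolP[s ind] maxm.
exists [seq \sum_i s i *+ e i | e : {ffun 'I_m -> 'I_p}] => a.
pose s' (i : 'I_m.+1) := if unlift ord0 i is Some j then s j else a.
have nind : ~ indep m.+1 s'.
  move=> ind'; have /maxm : E m.+1 by apply/asboolP; exists s'.
  by rewrite ltnn.
have [c [b rel pc]] : exists c : 'I_m.+1 -> int, exists2 b,
    \sum_i s' i *~ c i = p%:R * b & ~~ (p %| c ord0)%Z.
  apply: contrapT => no; apply: nind => c b rel.
  have pc0 : (p %| c ord0)%Z.
    by apply: contrapT => /negP pc; apply: no; exists c, b.
  move=> i; case: (unliftP ord0 i) => [j ->|-> //].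
  have /dvdzP[d dE] := pc0.
  apply: (ind (fun k => c (lift ord0 k)) (b - a *~ d)).
  rewrite mulrBr -rel big_ord_recl {1}/s' unlift_none dE mulrzA -pmulrn mulr_natl.
  by rewrite [RHS]addrC addKr; apply: eq_bigr => k _; rewrite /s' liftK.
have [u [v uv]] := prime_bezoutz hp pc.
move: rel; rewrite big_ord_recl {1}/s' unlift_none.
under eq_bigr => k _ do rewrite /s' liftK.
set T := \sum_(_ < _) _ => rel.
(* The relation is solved for [a] with the inverse [u] of its coefficient modulo p; the coefficients
   are then reduced modulo p. *)
pose r i : int := (- u * c (lift ord0 i))%R.
have ltr i : (absz (r i %% p)%Z < p)%N.
  by rewrite -ltz_nat gez0_abs ?modz_ge0 ?ltz_pmod ?ltz_nat // -?lt0n ?eqz_nat -?lt0n.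
exists (\sum_i s i *+ [ffun i => Ordinal (ltr i)] i).
  by apply/imageP; exists [ffun i => Ordinal (ltr i)].
exists (b *~ u + a *~ v + \sum_i s i *~ (r i %/ p)%Z).
have rE i : s i *~ r i = s i *+ (absz (r i %% p)%Z) + p%:R * (s i *~ (r i %/ p)%Z).
  rewrite {1}(divz_eq (r i) p) mulrzDr addrC pmulrn gez0_abs; last first.
    by rewrite modz_ge0 // eqz_nat -lt0n.
  by rewrite mulrzA -pmulrn mulr_natl.
have -> : \sum_i s i *+ [ffun i => Ordinal (ltr i)] i =
    T *~ (- u) - p%:R * \sum_i s i *~ (r i %/ p)%Z.
  rewrite mulr_sumr mulrz_suml -sumrB; apply: eq_bigr => i _.
  by rewrite ffunE /= -mulrzA mulrC rE addrK.
set S := \sum_(_ < _) _.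
have -> : T *~ - u - p%:R * S + p%:R * (b *~ u + a *~ v + S) =
    T *~ - u + p%:R * (b *~ u + a *~ v).
  by rewrite (mulrDr _ _ S) addrACA addNr addr0.
rewrite -[LHS]mulr1z -uv mulrzDr (mulrC u) !mulrzA.
have -> : a *~ c ord0 = p%:R * b - T by rewrite -rel addrK.
rewrite mulrzBl mulrDr mulrNz -mulrzAr -pmulrn !mulr_natl addrAC.
by rewrite [RHS]addrC.
Qed.

Lemma rational_coordinates (K : fieldExtType rat) (H : fieldExtType K) :
  exists N (f : {additive H -> 'rV[rat]_N}), injective f.
Proof.
pose f (x : H) : 'rV[rat]_(_ * _) := mxvec (\matrix_(i, j) v2r (v2r x 0 i) 0 j).
have f_zmod : zmod_morphism f.
  move=> x y; rewrite /f -raddfB /=; congr mxvec; apply/matrixP => i j.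
  by rewrite !mxE linearB /= !mxE linearB /= !mxE.
pose m := GRing.isZmodMorphism.Build _ _ f f_zmod.
pose F : {additive H -> 'rV[rat]_(_ * _)} := HB.pack f m.
exists _, F => x y /(can_inj mxvecK)/matrixP xy; apply: v2r_inj.
apply/rowP => i; apply: v2r_inj; apply/rowP => j.
by have := xy i j; rewrite !mxE.
Qed.

Lemma unit_quotient (B : comUnitRingType) (s w a v x v' : B) :
  s \is a GRing.unit -> w \is a GRing.unit -> s * a = v -> v * w = x * v' ->
  a = x * (s^-1 * w^-1 * v').
Proof.
move=> us uw av vw; apply: (mulrI us); apply: (mulrI uw).
by rewrite av mulrC vw !mulrA (mulrC (w * s)) mulrA !mulrK.
Qed.

Section RingOfIntegers.
Variables (K : fieldExtType rat) (H : splittingFieldType K).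
Local Notation A := (ring_of_integers H).

Lemma ring_of_integers_integral (a : A) : integralOver (intr : int -> H) (val a).
Proof. exact/asboolP/(valP a). Qed.

Lemma ring_of_integers_closed (x : H) :
  integralOver (intr : int -> H) x -> exists a : A, val a = x.
Proof. by move=> hx; exists (Sub x (asboolT hx)); rewrite SubK. Qed.

Lemma pnatr_neq0 (p : nat) : prime p -> p%:R != 0 :> A.
Proof.
move=> hp; apply/eqP => /(congr1 val); rewrite rmorph_nat rmorph0 => /eqP.
rewrite -(rmorph_nat (in_alg H)) fmorph_eq0 -(rmorph_nat (in_alg K)) fmorph_eq0.
by rewrite pnatr_eq0 eqn0Ngt prime_gt0.
Qed.

Lemma ring_of_integers_finite_mod (p : nat) : prime p ->
  exists L : seq A, forall a, exists2 x, x \in L & exists b, a = x + p%:R * b.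
Proof.
move=> hp; have [N [f f_inj]] := rational_coordinates H.
by apply: (@finite_mod_prime A N (f \o val)) hp => x y /f_inj/val_inj.
Qed.

Lemma ring_of_integers_root (q y b : A) i j : q != 0 -> (i < j)%N ->
  y ^+ j = q ^+ (j - i) * y ^+ i + q ^+ j * b -> exists c, y = q * c.
Proof.
have [V VE] : exists V : {rmorphism A -> H}, forall a, V a = val a by exists val.
move=> q0 ltij yE; pose z := V y / V q.
have V_inj : injective V by move=> a a'; rewrite !VE; exact: val_inj.
have q0' : V q != 0 by rewrite -(rmorph0 V) (inj_eq V_inj).
have [|c cE] := @ring_of_integers_closed z; last first.
  by exists c; apply: V_inj; rewrite rmorphM [V c]VE cE /z mulrCA divff // mulr1.
pose r : {poly A} := 'X^j - ('X^i + b%:P).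
have sr : (size ('X^i + b%:P : {poly A})%R < j.+1)%N.
  rewrite (leq_ltn_trans (size_polyD _ _)) // gtn_max size_polyXn !ltnS ltij.
  by rewrite (leq_trans (size_polyC_leq1 _)) // (leq_ltn_trans _ ltij).
have mr : r \is monic.
  apply/monicP; rewrite lead_coefDl ?size_polyN ?size_polyXn ?lead_coefXn //.
apply: (@integral_root_monic int H intr z (map_poly V r)).
- exact: monic_map.
- apply/rootP; rewrite rmorphB rmorphD /= !map_polyXn map_polyC !hornerE.
  apply: (mulfI (expf_neq0 j q0')); rewrite mulr0 /z !expr_div_n.
  have /(congr1 V) := yE; rewrite !(rmorphD, rmorphM, rmorphXn) /= => yE'.
  have qj : V q ^+ j = V q ^+ (j - i) * V q ^+ i by rewrite -exprD subnK // ltnW.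
  have E : V q ^+ j * (V y ^+ i / V q ^+ i) = V q ^+ (j - i) * V y ^+ i.
    rewrite qj -(mulrA (V q ^+ (j - i))); congr (_ * _).
    by rewrite mulrCA mulfV ?expf_neq0 // mulr1.
  by rewrite mulrBr mulrDr E mulrCA divff ?expf_neq0 // mulr1 yE' subrr.
- apply/integral_poly => k; rewrite coef_map /= VE; exact: ring_of_integers_integral.
Qed.

(** The integer is a nonzero constant term of an integral equation of [a]. *)
Lemma ring_of_integers_divides_int (a : A) : a != 0 ->
  exists (N : int) (b : A), N%:~R != 0 :> A /\ a * b = N%:~R.
Proof.
have [V VE] : exists V : {rmorphism A -> H}, forall a, V a = val a by exists val.
have V_inj : injective V by move=> x y; rewrite !VE; exact: val_inj.
move=> a0; have va0 : V a != 0 by rewrite -(rmorph0 V) (inj_eq V_inj).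
have hint : integralOver (intr : int -> H) (V a).
  by rewrite VE; exact: ring_of_integers_integral.
have [N [w [N0 hw NE]]] := @integral_constant_term int H intr _ hint va0.
have [b bE] := ring_of_integers_closed hw; exists N, b; split.
  apply: contraNneq N0 => /(congr1 V); rewrite rmorph_int rmorph0 => e.
  by apply/eqP; exact: e.
by apply: V_inj; rewrite rmorphM rmorph_int NE [V b]VE bE.
Qed.

Variables (P : prime_idealr A) (p : nat).
Hypotheses (hp : prime p) (hP : p%:R \in P).

Lemma int_in_prime (c : int) : (c%:~R \in P) = (p %| c)%Z.
Proof.
apply/idP/idP => [cP|/dvdzP[d ->]]; last by rewrite intrM idealMr.
apply: contraT => pc; have [u [v uv]] := prime_bezoutz hp pc.
have : (1 : A) \in P.
  have <- : (u * c + v * p)%:~R = 1 :> A by rewrite uv.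
  by rewrite intrD !intrM rpredD // idealMr.
by rewrite idealr1.
Qed.

Lemma ring_of_integers_invertible (w : A) : w \notin P -> exists w', 1 - w * w' \in P.
Proof.
have [L hL] := ring_of_integers_finite_mod hp.
exact: (invertible_mod hP hL).
Qed.

Lemma localization_generator : exists2 x : A, x \in P &
  forall a : localization P, a \in localization_ideal P -> exists b, a = loc P x * b.
Proof.
have [L hL] := ring_of_integers_finite_mod hp; have q0 := pnatr_neq0 hp.
have [|x [w [xP wP hx]]] := exists_local_generator q0 hP hL.
  by move=> y b i j; exact: ring_of_integers_root.
exists x => // a /localization_idealP[v [s [vP sP aE]]].
have [v' vw] := hx v vP; have us := loc_unit sP; have uw := loc_unit wP.
have vw' : loc P v * loc P w = loc P x * loc P v' by rewrite -!rmorphM vw.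
by exists ((loc P s)^-1 * (loc P w)^-1 * loc P v'); exact: unit_quotient us uw aE vw'.
Qed.

End RingOfIntegers.

(** * The element zeta_p - 1 as a uniformizer *)

Section Uniformizer.
Variables (A O : idomainType) (P : prime_idealr A) (l : {rmorphism A -> O}).
Hypothesis l_unit : forall s, (l s \is a GRing.unit) = (s \notin P).
Hypothesis l_frac : forall a : O, exists b s, s \notin P /\ l s * a = l b.
Hypothesis l_inj : injective l.
Variable p : nat.
Hypotheses (hp : prime p).
Hypothesis int_in_P : forall c : int, (c%:~R \in P) = (p %| c)%Z.
Hypothesis invertible : forall w, w \notin P -> exists w', 1 - w * w' \in P.
Hypothesis divides_int : forall a : A, a != 0 ->
  exists (N : int) (b : A), N%:~R != 0 :> A /\ a * b = N%:~R.
Variable x : A.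
Hypothesis xP : x \in P.
Hypothesis generator : forall a : O, a \isn't a GRing.unit -> exists b, a = l x * b.
Variable lam : A.
Hypotheses (lam0 : lam != 0) (zp : (1 + lam) ^+ p = 1).
Variables (beta : A) (c : 'I_p -> int).
Hypotheses (betaP : beta \in P) (betaP2 : ~ ideal_exp P 2 beta).
Hypotheses (c_rel : \sum_(i < p) beta ^+ i *~ c i = 0)
  (c_prim : exists i, ~~ (p %| c i)%Z).

Lemma p_in_P : p%:R \in P.
Proof. by rewrite pmulrn int_in_P dvdzz. Qed.

(** In the residue field, of characteristic p, (1 + lam)^p = 1 gives lam^p = 0. *)
Lemma lam_in_P : lam \in P.
Proof.
have [|E [phi [phi0 _]]] := @exists_residue_field A P.
  move=> a /invertible[b ab]; exists b; by rewrite -opprB rpredN.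
have chE : p \in [pchar E] by rewrite inE hp -(rmorph_nat phi) phi0 p_in_P.
have : pFrobenius_aut chE (phi lam) = 0.
  apply: (addrI 1); rewrite -{1}(rmorph1 (pFrobenius_aut chE)) -rmorphD addr0.
  by rewrite /= pFrobenius_autE -(rmorph1 phi) -rmorphD -rmorphXn zp.
by rewrite pFrobenius_autE -phi0 => /eqP; rewrite expf_eq0 => /andP[].
Qed.

Lemma root_slope_notin i : (0 < i < p)%N -> root_slope lam i \notin P.
Proof.
move=> /andP[i0 ltip].
have slope_mod : root_slope lam i - i%:R \in P.
  rewrite -[X in X%:R]card_ord -sumr_const -sumrB; apply: rpred_sum => j _.
  by rewrite root_slopeE addrC addKr mulrC idealMr // lam_in_P.
apply/negP => slopeP; have : i%:R \in P.
  by rewrite -[i%:R](subKr (root_slope lam i)) rpredB.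
by rewrite pmulrn int_in_P dvdzE gtnNdvd.
Qed.

Let X := l x.
Let Y := l lam.

Lemma X_nonunit : X \isn't a GRing.unit.
Proof. by rewrite l_unit negbK. Qed.

Lemma Y_nonunit : Y \isn't a GRing.unit.
Proof. by rewrite l_unit negbK lam_in_P. Qed.

Lemma X_neq0 : X != 0.
Proof.
have [b Yb] := generator Y_nonunit; apply: contraNneq lam0 => X0.
by rewrite -(inj_eq l_inj) rmorph0 -/Y Yb -/X X0 mul0r.
Qed.

Lemma l_p_factor : exists2 u, u \is a GRing.unit & l p%:R = Y ^+ p.-1 * u.
Proof.
exists (l (\prod_(i < p.-1) - root_slope lam i.+1)).
  rewrite l_unit; elim/big_ind: _ => [||i _].
  - by rewrite idealr1.
  - by move=> a b aP bP; exact: notin_primeM.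
  - by rewrite rpredN; apply: root_slope_notin; rewrite /= -ltn_predRL.
by rewrite (natr_prime_factor lam0 hp zp) rmorphM rmorphXn.
Qed.

(** Otherwise t beta = x^2 b with t outside [P]; an inverse t' of t modulo [P] gives beta = (1 - t
    t') beta + t' b x^2, an element of P^2. *)
Lemma beta_uniformizer : exists2 v, v \is a GRing.unit & l beta = X * v.
Proof.
have [|v bE] := @generator (l beta); first by rewrite l_unit negbK.
exists v => //; apply: contrapT => /negP/generator[v' vE]; apply: betaP2.
have [b [t [tP tv]]] := l_frac v'.
have tb : t * beta = x * x * b.
  by apply: l_inj; rewrite !rmorphM bE vE -tv -/X; ring.
have [t' tt'] := invertible tP.
exists 2, (fun i : 'I_2 => if i == ord0 then 1 else t' * b).
exists (fun i j => if i == ord0 then if j == ord0 then 1 - t * t' else beta else x).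
split=> [i j|]; first by do 2?case: ifP.
rewrite big_ord_recl big_ord1 /= !big_ord_recl !big_ord0 /=.
transitivity ((1 - t * t') * beta + t' * (t * beta)); first by ring.
by rewrite tb; ring.
Qed.

(* Otherwise [p] would lie in [(X ^ p)], so that the relation between the
   first [p] powers of [beta] would have only one term of lowest valuation. *)
Lemma lam_uniformizer : exists2 u, u \is a GRing.unit & Y = X * u.
Proof.
have [u YE] := generator Y_nonunit.
exists u => //; apply: contrapT => /negP/generator[u' uE].
have [v vU bE] := beta_uniformizer; rewrite -/X in bE uE YE.
have p1 := prime_gt1 hp.
(* p is a unit times lam^(p-1), which X^(2(p-1)) now divides, and 2(p-1) is at least p. *)
have [s pE] : exists s, l p%:R = X ^+ p * s.
  have [w _ ->] := l_p_factor; rewrite YE uE.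
  have -> : (X * (X * u')) ^+ p.-1 = X ^+ p * X ^+ (p.-1 + p.-1 - p) * u' ^+ p.-1.
    rewrite !exprMn mulrA -!exprD; congr (X ^+ _ * _); lia.
  by exists (X ^+ (p.-1 + p.-1 - p) * u' ^+ p.-1 * w); rewrite !mulrA.
have [i1 pi1] := c_prim.
(* [i0] is the least index with coefficient prime to p. Earlier terms carry a factor p, hence X^p,
   and later ones a power of beta above [i0]; the term at [i0] has valuation exactly [i0]. *)
case: (@arg_minnP _ i1 (fun i => ~~ (p %| c i)%Z) (fun i : 'I_p => i : nat) pi1).
move=> i0 pi0 mini0.
have other i : i != i0 -> exists r, l beta ^+ i *~ c i = X ^+ i0.+1 * r.
  rewrite -val_eqE /= neq_ltn => /orP[lti|lti].
    have /dvdzP[d ->] : (p %| c i)%Z.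
      by apply: contraT => /mini0; rewrite leqNgt lti.
    exists (l beta ^+ i *~ d * (X ^+ (p - i0.+1) * s)).
    rewrite mulrzA -pmulrn -mulr_natr -(rmorph_nat l) pE.
    have -> : X ^+ p = X ^+ i0.+1 * X ^+ (p - i0.+1) by rewrite -exprD subnKC.
    by move: (_ *~ d) => a; ring.
  exists (X ^+ (i - i0.+1) * v ^+ i *~ c i).
  by rewrite bE exprMn mulrzAr mulrA -exprD subnKC // mulrzAr.
have /choice[r hr] : forall i, exists r, i != i0 ->
  l beta ^+ i *~ c i = X ^+ i0.+1 * r.
  by move=> i; case: eqVneq => [_|/other[r]]; [exists 0|exists r].
have : v ^+ i0 *~ c i0 = - (X * \sum_(i | i != i0) r i).
  apply: (mulfI (expf_neq0 i0 X_neq0)); apply/eqP; rewrite mulrN -addr_eq0; apply/eqP.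
  have /(congr1 l) := c_rel; rewrite rmorph0 rmorph_sum (bigD1 i0) //= => rel0.
  rewrite -[RHS]rel0 rmorphMz rmorphXn bE exprMn mulrzAr; congr (_ + _).
  rewrite mulrA -exprSr mulr_sumr; apply: eq_bigr => i ii0.
  by rewrite -hr // rmorphMz rmorphXn.
move=> E; have : v ^+ i0 *~ c i0 \is a GRing.unit.
  by rewrite -mulrzr unitrM unitrX //= -(rmorph_int l) l_unit int_in_P.
by rewrite E unitrN unitrM (negPf X_nonunit).
Qed.

Lemma nonunit_divisible (a : O) : a \isn't a GRing.unit -> exists b, a = Y * b.
Proof.
move=> /generator[b ->]; have [u uU YE] := lam_uniformizer.
by exists (u^-1 * b); rewrite YE -mulrA mulVKr.
Qed.

Lemma l_int_factor (N : int) : N != 0 ->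
  exists u k, u \is a GRing.unit /\ l N%:~R = u * Y ^+ k.
Proof.
move sE : (absz N) => s; elim/ltn_ind: s N sE => s IH N sE N0.
have [/dvdzP[d dE]|pN] := boolP (p %| N)%Z; last first.
  by exists (l N%:~R), 0%N; rewrite mulr1 l_unit int_in_P.
have d0 : d != 0 by apply: contraNneq N0 => d0; rewrite dE d0 mul0r.
have [|u [k [uU dk]]] := IH (absz d) _ d erefl d0.
  by rewrite -sE dE abszM ltn_Pmulr ?absz_gt0 // prime_gt1.
have [w wU pE] := l_p_factor; exists (u * w), (k + p.-1)%N.
rewrite unitrM uU wU dE intrM rmorphM dk -pmulrn pE; split=> //.
by rewrite exprD; ring.
Qed.

Lemma divisor_of_power (K : nat) (a b w : O) : w \is a GRing.unit ->
  a * b = w * Y ^+ K -> exists u k, u \is a GRing.unit /\ a = u * Y ^+ k.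
Proof.
have Y0 : Y != 0 by rewrite -(rmorph0 l) (inj_eq l_inj).
move=> wU; elim: K a => [|K IH] a.
  move=> ab; exists a, 0%N; rewrite mulr1; split=> //.
  have : a * b \is a GRing.unit by rewrite ab mulr1.
  by rewrite unitrM => /andP[].
have [aU _|/nonunit_divisible[a' ->]] := boolP (a \is a GRing.unit).
  by exists a, 0%N; rewrite mulr1.
rewrite -mulrA exprS [RHS]mulrCA => /(mulfI Y0)/IH[u [k [uU ->]]].
by exists u, k.+1; rewrite exprS mulrCA.
Qed.

(** A nonzero element divides a nonzero integer, which is a unit times a power of [Y], and so is
    each of its divisors. *)
Theorem lam_is_uniformizer : is_uniformizer Y.
Proof.
split; [by rewrite -(rmorph0 l) (inj_eq l_inj)|exact: Y_nonunit|] => a a0.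
have [b [s [sP sa]]] := l_frac a.
have ls : l s \is a GRing.unit by rewrite l_unit.
have b0 : b != 0.
  by rewrite -(inj_eq l_inj) rmorph0 -sa mulf_neq0 //; apply: contraTneq ls => ->;
    rewrite unitr0.
have [N [r [N0 br]]] := divides_int b0.
have [|w [K [wU NE]]] := @l_int_factor N.
  by apply: contraNneq N0 => ->.
apply: (@divisor_of_power K a (l s * l r) w wU).
by rewrite -NE -br rmorphM -sa mulrCA mulrA.
Qed.

End Uniformizer.

Lemma primitive_root_neq1 (R : idomainType) (p : nat) (z : R) :
  prime p -> p.-primitive_root z -> z != 1.
Proof.
move=> hp hz; apply/eqP => z1; have := prim_order_dvd hz 1.
by rewrite expr1 z1 eqxx dvdn1 gtn_eqF // prime_gt1.
Qed.

(** The minimal polynomial of [z] divides 1 + X + ... + X^(p-1). *)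
Lemma dim_prime_cyclotomic (p : nat) (K : fieldExtType rat) (z : K) :
  prime p -> p.-primitive_root z -> <<1%AS; z>>%VS = {:K}%VS ->
  (\dim {:K} < p)%N.
Proof.
move=> hp hz hK; rewrite -hK dim_Fadjoin dimv1 muln1.
pose q : {poly K} := \sum_(i < p) 'X^i.
have q1 : q \is a polyOver 1%VS by apply: rpred_sum => i _; exact: polyOverXn.
have sq : q = \poly_(i < p) 1 by rewrite poly_def; apply: eq_bigr => i _;
  rewrite scale1r.
have {}sq : size q = p.
  by rewrite sq size_poly_eq // oner_neq0.
have qz : root q z.
  apply/rootP; apply: (mulfI (x := z - 1)).
    by rewrite subr_eq0; exact: primitive_root_neq1 hz.
  have -> : q.[z] = \sum_(i < p) z ^+ i.
    by rewrite horner_sum; apply: eq_bigr => i _; rewrite hornerXn.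
  by rewrite mulr0 -subrX1 (prim_expr_order hz) subrr.
have q0 : q != 0 by rewrite -size_poly_eq0 sq -lt0n prime_gt0.
have := dvdp_leq q0 (minPoly_dvdp q1 qz).
by rewrite size_minPoly sq.
Qed.

(** As [b] comes from [K], of degree less than p, its first p powers are linearly dependent over the
    rationals. *)
Lemma ring_of_integers_power_relation (p : nat) (K : fieldExtType rat)
    (H : splittingFieldType K) (b : ring_of_integers K) :
  prime p -> (\dim {:K} < p)%N ->
  exists2 c : 'I_p -> int, \sum_(i < p) integers_incl H b ^+ i *~ c i = 0 &
    exists i, ~~ (p %| c i)%Z.
Proof.
rewrite dimvf => hp ltKp.
pose f : {additive K -> 'rV[rat]_(dim K)} := @VectorInternalTheory.v2r rat K.
have f_inj : injective f by exact: VectorInternalTheory.v2r_inj.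
have [c rel pc] := int_relation f_inj hp (fun i => val b ^+ i) ltKp.
exists c => //; apply: val_inj; rewrite rmorph0.
transitivity (in_alg H (\sum_(i < p) val b ^+ i *~ c i)); last by rewrite rel rmorph0.
rewrite !rmorph_sum; apply: eq_bigr => i _.
by rewrite rmorphMz rmorphXn [RHS]rmorphMz rmorphXn.
Qed.

Lemma cohen_macaulay_congruent1 (O : idomainType) (pi : O) (I : idealr O) (p : nat)
    (gT : finGroupType) (G : {group gT}) (rG : mx_representation O G 3) :
  is_uniformizer pi -> prime p -> (1 + pi) ^+ p = 1 ->
  (forall a, a \in I <-> exists b, a = pi * b) -> (p.-group G)%g ->
  (forall g, g \in G -> map_mx \pi_{ideal_quot I} (rG g) = 1%:M) ->
  cohen_macaulay (invariant_ring rG).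
Proof.
move=> hpi hp zp hI pG triv.
have [|k [phi [phi0 phi_surj]]] := @exists_residue_field O I.
  have [_ _ dvr] := hpi; move=> a aI.
  have a0 : a != 0 by apply: contraNneq aI => ->; exact: rpred0.
  have [u [[|n] [uU aE]]] := dvr _ a0.
    by exists u^-1; rewrite aE mulr1 divrr // subrr rpred0.
  by case/negP: aI; apply/hI; exists (u * pi ^+ n); rewrite aE exprS mulrCA.
have /choice[h hE] : forall g, exists X : 'M[O]_3, g \in G -> rG g = 1 + pi *: X.
  move=> g; have [gG|_] := boolP (g \in G); last by exists 0.
  have /choice[x hx] : forall ij : 'I_3 * 'I_3, exists b,
      rG g ij.1 ij.2 - (1%:M : 'M[O]_3) ij.1 ij.2 = pi * b.
    move=> [i j]; apply/hI; rewrite Quotient.idealrBE; apply/eqP.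
    have /matrixP/(_ i j) := triv g gG; rewrite !mxE => ->.
    by rewrite rmorph_nat.
  exists (\matrix_(i, j) x (i, j)) => _; apply/matrixP => i j.
  by rewrite !mxE -hx /= mxE addrC subrK.
have phi0' a : phi a = 0 <-> exists b, a = pi * b.
  by rewrite -hI -phi0; split=> /eqP.
have [C Cu [d hd]] := simultaneous_diagonalization hpi hp zp phi0' phi_surj pG hE.
exact: (cohen_macaulay_diagonalizable (mulmxV Cu) (mulVmx Cu) hd hpi).
Qed.

Theorem theorem1p3 (p : nat) (hp : prime p)
    (K : fieldExtType rat) (z : K) (hz : p.-primitive_root z)
    (hK : <<1%AS; z>>%VS = {:K}%VS)
    (H : splittingFieldType K) (hH : hilbert_class_field H)
    (P : prime_idealr (ring_of_integers H)) (hP : p%:R \in P)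
    (gT : finGroupType) (G : {group gT}) (hG : (p.-group G)%g)
    (rG : mx_representation (localization P) G 3) (hrG : mx_faithful rG)
    (htriv : forall g, g \in G ->
       map_mx \pi_{ideal_quot (localization_ideal P)} (rG g) = 1%:M) :
  cohen_macaulay (invariant_ring rG).
Proof.
have [lam [lam0 zp]] : exists lam : ring_of_integers H,
  lam != 0 /\ (1 + lam) ^+ p = 1.
  have [V VE] : exists V : {rmorphism ring_of_integers H -> H}, forall a, V a = val a.
    by exists val.
  have V_inj : injective V by move=> a b; rewrite !VE; exact: val_inj.
  have zHp : in_alg H z ^+ p = 1 by rewrite -rmorphXn (prim_expr_order hz) rmorph1.
  have [|ze zeE] := @ring_of_integers_closed K H (in_alg H z).
    exists ('X^p - 1%:P); first by rewrite monicXnsubC ?prime_gt0.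
    by rewrite rmorphB /= map_polyXn map_polyC rootE !hornerE /= zHp rmorph1 subrr.
  have zeK : 1 + (ze - 1) = ze by rewrite addrC subrK.
  exists (ze - 1); rewrite zeK; split; last first.
    by apply: V_inj; rewrite rmorphXn rmorph1 VE zeE.
  rewrite subr_eq0 -(inj_eq V_inj) VE zeE !rmorph1 -(rmorph1 (in_alg H)) fmorph_eq.
  exact: primitive_root_neq1 hz.
(* Ramification index 1 at [P]: not every element of [K] lying in [P] lies in P^2. *)
have [b [bP bP2]] : exists b : ring_of_integers K,
    integers_incl H b \in P /\ ~ ideal_exp P 2 (integers_incl H b).
  have [[_ _ unram _] _] := hH.
  have [|_ nP2] := unram P.
    by exists p%:R => //; exact: pnatr_neq0.
  apply: contrapT => no; apply: nP2 => b bP; apply: contrapT => bP2.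
  by apply: no; exists b.
have [c c_rel c_prim] :=
  ring_of_integers_power_relation H b hp (dim_prime_cyclotomic hp hz hK).
have [x xP gen] := localization_generator hp hP.
have l_unit s : (loc P s \is a GRing.unit) = (s \notin P).
  apply/idP/idP => [u|]; last exact: loc_unit.
  rewrite -loc_in_ideal; apply/negP => sP.
  have : (1 : localization P) \in localization_ideal P.
    by rewrite -(mulVr u) idealMr.
  by rewrite idealr1.
have nonunit_gen (a : localization P) : a \isn't a GRing.unit ->
  exists b, a = loc P x * b.
  move=> aU; apply: gen; apply: contraNT aU.
  exact: unit_of_notin_localization_ideal.
have unif : is_uniformizer (loc P lam).
  exact: (lam_is_uniformizer l_unit (@locP _ P) (@loc_inj _ P) hp
    (int_in_prime hp hP) (ring_of_integers_invertible hp hP)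
    (@ring_of_integers_divides_int K H) xP nonunit_gen lam0 zp bP bP2 c_rel c_prim).
have lam_div (a : localization P) : a \isn't a GRing.unit ->
  exists b, a = loc P lam * b.
  exact: (nonunit_divisible l_unit (@locP _ P) (@loc_inj _ P) hp
    (int_in_prime hp hP) (ring_of_integers_invertible hp hP)
    xP nonunit_gen lam0 zp bP bP2 c_rel c_prim).
apply: (cohen_macaulay_congruent1 unif hp _ _ hG htriv);
  first by rewrite -(rmorph1 (loc P)) -rmorphD -rmorphXn zp.
move=> a; split=> [aP|[d ->]]; last first.
  rewrite mulrC idealMr // loc_in_ideal.
  exact: (lam_in_P hp (int_in_prime hp hP) (ring_of_integers_invertible hp hP) zp).
apply: lam_div; apply/negP => u.
have : (1 : localization P) \in localization_ideal P by rewrite -(mulVr u) idealMr.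
by rewrite idealr1.
Qed.
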